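(* Let $f:\mathbb{R}^n\to\mathbb{R}$ be convex and satisfy the standing assumption given in the context, let $\lambda>0$, and let $x_*$ be the unique minimizer of $F(x)=f(x)+\lambda\|x\|_1$ over $\mathbb{R}^n$. If in Algorithm FaRSA (described in the context) the tolerance $\epsilon$ in the termination condition is replaced by zero, then either: (i) there exists an iteration $k$ such that $x_k=x_*$; or (ii) infinitely many iterates $\{x_k\}$ are computed and they satisfy $$\lim_{k\to\infty}x_k=x_*,\qquad \lim_{k\to\infty}\phi(x_k)=0,\qquad\text{and}\qquad \lim_{k\to\infty}\beta(x_k)=0.$$
   Context: Notation. $\|\cdot\|$ is the $\ell_2$-norm and $\|\cdot\|_1$ the $\ell_1$-norm on $\mathbb{R}^n$. For an index set $\mathcal{I}\subseteq\{1,\dots,n\}$, $[v]_{\mathcal{I}}$ is the subvector of $v$ with indices in $\mathcal{I}$ and $[M]_{\mathcal{I}\mathcal{I}}$ the corresponding submatrix of a symmetric matrix $M$. $\mathrm{sgn}(v)$ is the componentwise sign ($0$, $1$ or $-1$ according to whether the component is zero, positive or negative). Problem. $\min_{x\in\mathbb{R}^n}F(x)$, $F(x):=f(x)+\lambda\|x\|_1$, $\lambda>0$. Standing assumption. $f:\mathbb{R}^n\to\mathbb{R}$ is convex, twice continuously differentiable, and bounded below on the level set $\mathcal{L}:=\{x\in\mathbb{R}^n:F(x)\le F(x_0)\}$; $\nabla f$ is Lipschitz continuous on $\mathcal{L}$ with constant $L>0$; and there are constants $\theta_{\min},\theta_{\max}>0$ with $\theta_{\min}\|v\|^2\le v^T\nabla^2f(x)v\le\theta_{\max}\|v\|^2$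 for all $x\in\mathcal{L}$, $v\in\mathbb{R}^n$. Optimality measures. Let $\mathcal{I}^0(x)=\{i:[x]_i=0\}$, $\mathcal{I}^+(x)=\{i:[x]_i>0\}$, $\mathcal{I}^-(x)=\{i:[x]_i<0\}$. Define $[\beta(x)]_i=[\nabla f(x)]_i+\lambda$ if $i\in\mathcal{I}^0(x)$ and $[\nabla f(x)]_i+\lambda<0$; $[\beta(x)]_i=[\nabla f(x)]_i-\lambda$ if $i\in\mathcal{I}^0(x)$ and $[\nabla f(x)]_i-\lambda>0$; $[\beta(x)]_i=0$ otherwise. Define $[\phi(x)]_i=0$ if $i\in\mathcal{I}^0(x)$; $[\phi(x)]_i=\min\{[\nabla f(x)]_i+\lambda,\max\{[x]_i,[\nabla f(x)]_i-\lambda\}\}$ if $i\in\mathcal{I}^+(x)$ and $[\nabla f(x)]_i+\lambda>0$; $[\phi(x)]_i=\max\{[\nabla f(x)]_i-\lambda,\min\{[x]_i,[\nabla f(x)]_i+\lambda\}\}$ if $i\in\mathcal{I}^-(x)$ and $[\nabla f(x)]_i-\lambda<0$; $[\phi(x)]_i=[\nabla f(x)+\lambda\,\mathrm{sgn}(x)]_i$ otherwise. Projection. $[\mathrm{Proj}(y;x)]_i=\max\{0,[y]_i\}$ if $i\in\mathcal{I}^+(x)$, $\min\{0,[y]_i\}$ if $i\in\mathcal{I}^-(x)$, and $0$ if $i\in\mathcal{I}^0(x)$. Algorithm FaRSA. Input $x_0\in\mathbb{R}^n$; constants $\eta_\phi,\eta_\beta\in(0,1]$, $\xi\in(0,1)$,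 $\eta\in(0,1/2]$, $\gamma\in(0,\infty)$, and a tolerance $\epsilon$ (for this result $\epsilon=0$). For $k=0,1,2,\dots$: if $\max\{\|\beta(x_k)\|,\|\phi(x_k)\|\}\le\epsilon$, return $x_k$. Otherwise: ($\phi$-branch) If $\|\beta(x_k)\|\le\gamma\|\phi(x_k)\|$: choose any $\mathcal{I}_k\subseteq\{i:[\phi(x_k)]_i\ne0\}$ with $\|[\phi(x_k)]_{\mathcal{I}_k}\|\ge\eta_\phi\|\phi(x_k)\|$. Set $H_k=[\nabla^2F(x_k)]_{\mathcal{I}_k\mathcal{I}_k}=[\nabla^2f(x_k)]_{\mathcal{I}_k\mathcal{I}_k}$ and $g_k=[\nabla F(x_k)]_{\mathcal{I}_k}=[\nabla f(x_k)+\lambda\,\mathrm{sgn}(x_k)]_{\mathcal{I}_k}$ (all components of $x_k$ in $\mathcal{I}_k$ are nonzero). Let $d_k^R=-\alpha_kg_k$ with $\alpha_k=\|g_k\|^2/(g_k^TH_kg_k)$, and $m_k(d)=g_k^Td+\tfrac12d^TH_kd$. Compute any $\bar d_k$ with $g_k^T\bar d_k\le g_k^Td_k^R$ and $m_k(\bar d_k)\le m_k(0)$. Set $[d_k]_{\mathcal{I}_k}=\bar d_k$ and $[d_k]_i=0$ for $i\notin\mathcal{I}_k$. Obtain $x_{k+1}$ by Linesearch-$\phi$. ($\beta$-branch) Otherwise: choose any $\mathcal{I}_k\subseteq\{i:[\beta(x_k)]_i\ne0\}$ with $\|[\beta(x_k)]_{\mathcal{I}_k}\|\ge\eta_\beta\|\beta(x_k)\|$.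 Set $[d_k]_{\mathcal{I}_k}=-[\beta(x_k)]_{\mathcal{I}_k}$ and $[d_k]_i=0$ for $i\notin\mathcal{I}_k$. Obtain $x_{k+1}$ by Linesearch-$\beta$. Linesearch-$\phi$. Set $j=0$, $y_0=\mathrm{Proj}(x_k+d_k;x_k)$. While $\mathrm{sgn}(y_j)\ne\mathrm{sgn}(x_k)$: if $F(y_j)\le F(x_k)$, return $x_{k+1}=y_j$; else replace $j$ by $j+1$ and set $y_j=\mathrm{Proj}(x_k+\xi^jd_k;x_k)$. After the while-loop, if $j\ne0$: let $\alpha_B=\sup\{\alpha>0:\mathrm{sgn}(x_k+\alpha d_k)=\mathrm{sgn}(x_k)\}$, and if $F(x_k+\alpha_Bd_k)\le F(x_k)+\eta\alpha_Bg_k^T\bar d_k$, return $x_{k+1}=x_k+\alpha_Bd_k$. Otherwise (or if $j=0$), starting from the current $j$, return $x_{k+1}=x_k+\xi^jd_k$ as soon as $F(x_k+\xi^jd_k)\le F(x_k)+\eta\xi^jg_k^T\bar d_k$, increasing $j$ by one after each failure. Linesearch-$\beta$. Return $x_{k+1}=x_k+\xi^jd_k$ for the smallest integer $j\ge0$ with $F(x_k+\xi^jd_k)\le F(x_k)-\eta\xi^j\|d_k\|^2$. *)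

(* Defs.v *)
(* R^n is 'rV[R]_n, vectors are rows. *)
From HB Require Import structures.
From mathcomp Require Import all_boot all_order all_algebra.
From mathcomp Require Import all_classical all_reals all_analysis.
Set Implicit Arguments.
Unset Strict Implicit.
Unset Printing Implicit Defensive.
Import Order.TTheory GRing.Theory Num.Theory.
Import numFieldNormedType.Exports.
Local Open Scope classical_set_scope.
Local Open Scope ring_scope.

Section Vectors.
Context {R : realType}.

Definition dot m (u v : 'rV[R]_m) : R := \sum_i u 0 i * v 0 i.

(* The library norm `|v| on 'rV_m is the sup norm; it is used below only
   through the topology it induces, which is the Euclidean one. *)
Definition norm2 m (v : 'rV[R]_m) : R := Num.sqrt (\sum_i v 0 i ^+ 2).

Definition norm1 m (v : 'rV[R]_m) : R := \sum_i `|v 0 i|.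

Definition sgnv m (v : 'rV[R]_m) : 'rV[R]_m := map_mx Num.sg v.

(* v^T M v *)
Definition quad m (M : 'M[R]_m) (v : 'rV[R]_m) : R := dot (v *m M) v.

(* [v]_I and [M]_{II}: the indices in I are listed in increasing order. *)
Definition subvec n (I : {set 'I_n}) (v : 'rV[R]_n) : 'rV[R]_#|I| :=
  \row_j v 0 (enum_val j).

Definition submat n (I : {set 'I_n}) (M : 'M[R]_n) : 'M[R]_#|I| :=
  \matrix_(i, j) M (enum_val i) (enum_val j).

End Vectors.

Section Calculus.
Context {R : realType} {n : nat}.
Implicit Types (f : 'rV[R]_n -> R) (x : 'rV[R]_n).

Definition grad f x : 'rV[R]_n := \row_i 'D_(delta_mx 0 i) f x.

(* The (i, j) entry is the i-th partial derivative of the j-th component of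
   the gradient. *)
Definition hess f x : 'M[R]_n := 'J (grad f) x.

Definition twice_continuously_differentiable f : Prop :=
  [/\ forall x, differentiable f x,
      forall x, differentiable (grad f) x
    & continuous (hess f)].

Definition objective f (lambda : R) x : R := f x + lambda * norm1 x.

Definition level_set f (lambda : R) (x0 : 'rV[R]_n) : set 'rV[R]_n :=
  [set x | objective f lambda x <= objective f lambda x0].

Record standing_assumption f (lambda : R) (x0 : 'rV[R]_n) : Prop := {
  sa_convex : convex_function [set: 'rV[R]_n] f;
  sa_C2 : twice_continuously_differentiable f;
  sa_bounded_below :
    exists m : R, forall x, level_set f lambda x0 x -> m <= f x;
  sa_lipschitz : exists2 L : R, 0 < L &
    forall x y, level_set f lambda x0 x -> level_set f lambda x0 y ->
      norm2 (grad f x - grad f y) <= L * norm2 (x - y);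
  sa_hessian : exists theta_min theta_max : R,
    [/\ 0 < theta_min, 0 < theta_max &
      forall x v, level_set f lambda x0 x ->
        theta_min * norm2 v ^+ 2 <= quad (hess f x) v
          <= theta_max * norm2 v ^+ 2]
}.

Definition minimizer (F : 'rV[R]_n -> R) x : Prop := forall y, F x <= F y.

End Calculus.

Section FaRSA.
Context {R : realType} {n : nat}.
Variables (f : 'rV[R]_n -> R) (lambda : R).
Implicit Types (x y z d : 'rV[R]_n) (I : {set 'I_n}) (i : 'I_n).

Local Notation F := (objective f lambda).

Definition beta x : 'rV[R]_n := \row_i
  let g := grad f x 0 i in
  if x 0 i == 0 then
    if g + lambda < 0 then g + lambda
    else if 0 < g - lambda then g - lambda
    else 0
  else 0.

Definition phi x : 'rV[R]_n := \row_i
  let g := grad f x 0 i in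
  if x 0 i == 0 then 0
  else if (0 < x 0 i) && (0 < g + lambda) then
    Num.min (g + lambda) (Num.max (x 0 i) (g - lambda))
  else if (x 0 i < 0) && (g - lambda < 0) then
    Num.max (g - lambda) (Num.min (x 0 i) (g + lambda))
  else (grad f x + lambda *: sgnv x) 0 i.

Definition Proj y x : 'rV[R]_n := \row_i
  if 0 < x 0 i then Num.max 0 (y 0 i)
  else if x 0 i < 0 then Num.min 0 (y 0 i)
  else 0.

Definition reduced_grad x I : 'rV[R]_#|I| :=
  subvec I (grad f x + lambda *: sgnv x).

Definition reduced_hess x I : 'M[R]_#|I| := submat I (hess f x).

Definition model x I (d : 'rV[R]_#|I|) : R :=
  dot (reduced_grad x I) d + 2^-1 * quad (reduced_hess x I) d.

(* d_k^R *)
Definition reference_dir x I : 'rV[R]_#|I| :=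
  let g := reduced_grad x I in
  - ((norm2 g ^+ 2 / quad (reduced_hess x I) g) *: g).

Variables (eta_phi eta_beta xi eta gamma eps : R).

(* dbar and d are the vectors \bar d_k and d_k of the phi-branch. *)
Record phi_direction x I (dbar : 'rV[R]_#|I|) d : Prop := {
  phi_dir_support : forall i, i \in I -> phi x 0 i != 0;
  phi_dir_large : norm2 (subvec I (phi x)) >= eta_phi * norm2 (phi x);
  phi_dir_descent :
    dot (reduced_grad x I) dbar <= dot (reduced_grad x I) (reference_dir x I);
  phi_dir_model : model x dbar <= model x (0 : 'rV[R]_#|I|);
  phi_dir_in : subvec I d = dbar;
  phi_dir_out : forall i, i \notin I -> d 0 i = 0
}.

Record beta_direction x I d : Prop := {
  beta_dir_support : forall i, i \in I -> beta x 0 i != 0;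
  beta_dir_large : norm2 (subvec I (beta x)) >= eta_beta * norm2 (beta x);
  beta_dir_in : subvec I d = - subvec I (beta x);
  beta_dir_out : forall i, i \notin I -> d 0 i = 0
}.

(* Backtracking from the exponent j: returns z = x + xi^m d for the least
   m >= j with F (x + xi^m d) <= F x + xi^m * slope. *)
Inductive backtrack x d (slope : R) (j : nat) z : Prop :=
| BacktrackAccept of
    F (x + xi ^+ j *: d) <= F x + xi ^+ j * slope & z = x + xi ^+ j *: d
| BacktrackNext of
    ~~ (F (x + xi ^+ j *: d) <= F x + xi ^+ j * slope)
    & backtrack x d slope j.+1 z.

(* The set is nonempty and bounded above whenever the line search uses it,
   so that sup is the actual supremum. *)
Definition alphaB x d : R :=
  sup [set a : R | 0 < a /\ sgnv (x + a *: d) = sgnv x].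

Definition alphaB_accepted x d (slope : R) : bool :=
  F (x + alphaB x d *: d) <= F x + eta * alphaB x d * slope.

Definition trial x d (j : nat) : 'rV[R]_n := Proj (x + xi ^+ j *: d) x.

(* linesearch_phi_from x d slope j z: the while loop, entered with the given
   value of j, and the instructions that follow it return z.  Here slope is
   g_k^T \bar d_k. *)
Inductive linesearch_phi_from x d (slope : R) (j : nat) z : Prop :=
| LphiReturn of
    sgnv (trial x d j) != sgnv x & F (trial x d j) <= F x & z = trial x d j
| LphiNext of
    sgnv (trial x d j) != sgnv x & ~~ (F (trial x d j) <= F x)
    & linesearch_phi_from x d slope j.+1 z
| LphiAlphaB of
    sgnv (trial x d j) == sgnv x & j != 0%N
    & alphaB_accepted x d slope & z = x + alphaB x d *: d
| LphiBacktrack of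
    sgnv (trial x d j) == sgnv x
    & (j == 0%N) || ~~ alphaB_accepted x d slope
    & backtrack x d (eta * slope) j z.

Definition linesearch_phi x d (slope : R) z : Prop :=
  linesearch_phi_from x d slope 0 z.

Definition linesearch_beta x d z : Prop :=
  backtrack x d (- (eta * norm2 d ^+ 2)) 0 z.

Definition terminate x : bool := Num.max (norm2 (beta x)) (norm2 (phi x)) <= eps.

Definition phi_branch x : bool := norm2 (beta x) <= gamma * norm2 (phi x).

(* None stands for a line search that runs forever. *)
Definition outcome (returns : 'rV[R]_n -> Prop) (o : option 'rV[R]_n) : Prop :=
  if o is Some z then returns z else forall z, ~ returns z.

(* iteration x o: an iteration started at x may result in o, where None means
   that no further iterate is computed.  This covers termination, but also the
   absence of an admissible direction and a line search that does not return:
   neither failure is excluded by definition. *)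
Inductive iteration x (o : option 'rV[R]_n) : Prop :=
| ItTerminate of terminate x & o = None
| ItPhi I (dbar : 'rV[R]_#|I|) d of
    ~~ terminate x & phi_branch x & phi_direction x dbar d
    & outcome (linesearch_phi x d (dot (reduced_grad x I) dbar)) o
| ItPhiFail of
    ~~ terminate x & phi_branch x
    & (forall I (dbar : 'rV[R]_#|I|) d, ~ phi_direction x dbar d) & o = None
| ItBeta I d of
    ~~ terminate x & ~~ phi_branch x & beta_direction x I d
    & outcome (linesearch_beta x d) o
| ItBetaFail of
    ~~ terminate x & ~~ phi_branch x
    & (forall I d, ~ beta_direction x I d) & o = None.

(* X k is the k-th iterate, or None if the run computes no k-th iterate. *)
Definition farsa_run (x0 : 'rV[R]_n) (X : nat -> option 'rV[R]_n) : Prop :=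
  X 0%N = Some x0 /\
  forall k, if X k is Some x then iteration x (X k.+1) else X k.+1 = None.

End FaRSA.

(* Main.v *)
Require Import Defs.
From mathcomp Require Import all_boot all_order all_algebra.
From mathcomp Require Import all_classical all_reals all_analysis.
From mathcomp Require Import ring lra.
Import Order.TTheory GRing.Theory Num.Theory.
Import numFieldNormedType.Exports.
Local Open Scope classical_set_scope.
Local Open Scope ring_scope.
Set Implicit Arguments.
Unset Strict Implicit.
Unset Printing Implicit Defensive.

(** Each iteration either deletes a coordinate from the set of nonzeros without
    increasing the objective [F], or decreases [F] by a fixed multiple of the
    squared residual [|phi x|^2 + |beta x|^2] ([iteration_step]).  The first
    kind occurs at most [n] times in a row, so if [F - F xstar] stayed above
    some [e > 0] the second kind would recur forever; but the residual is then
    bounded below ([residual_bounded_below]), and [F] would tend to minus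
    infinity ([no_persistent_descent]).  Hence [F] converges to its minimum
    along the iterates, quadratic growth around the minimizer
    ([quadratic_growth]) turns this into convergence of the iterates, and [phi]
    and [beta], although discontinuous, are continuous at a minimizer
    ([coord_residual_small]).

    The decrease rests on one estimate, [armijo_short_step]: along a segment on
    which the l1-norm is linear, all steps shorter than a constant satisfy the
    Armijo condition.  It serves the beta-branch, the backtracking of the
    phi-branch, and, read backwards, the breakpoint [alphaB] of the phi-branch:
    when the step to the breakpoint is rejected, the breakpoint is far away, so
    the steps tried after it are not small.  An accepted breakpoint may be
    arbitrarily close, as may a projected step that changes signs, but both
    create a new zero.

    The residual controls the gap of [F] coordinate by coordinate, through the
    tangent inequality of the convex function [f] ([coord_gap_le],
    [objective_gap_le]).  With residual zero this also shows that the algorithm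
    stops only at a minimizer. *)

(** * Inner products and restrictions to lines *)

Section InnerProduct.
Context {R : realType} {m : nat}.
Implicit Types (u v w : 'rV[R]_m) (a : R).

Lemma dotC u v : dot u v = dot v u.
Proof. by apply: eq_bigr => i _; rewrite mulrC. Qed.

Lemma dotDl u v w : dot (u + v) w = dot u w + dot v w.
Proof. by rewrite /dot -big_split; apply: eq_bigr => i _; rewrite mxE mulrDl. Qed.

Lemma dotZl a u v : dot (a *: u) v = a * dot u v.
Proof. by rewrite /dot mulr_sumr; apply: eq_bigr => i _; rewrite mxE mulrA. Qed.

Lemma dotNl u v : dot (- u) v = - dot u v.
Proof. by rewrite -scaleN1r dotZl mulN1r. Qed.

Lemma dotBl u v w : dot (u - v) w = dot u w - dot v w.
Proof. by rewrite dotDl dotNl. Qed.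

Lemma dotDr u v w : dot w (u + v) = dot w u + dot w v.
Proof. by rewrite dotC dotDl !(dotC w). Qed.

Lemma dotZr a u v : dot u (a *: v) = a * dot u v.
Proof. by rewrite dotC dotZl dotC. Qed.

Lemma dotNr u v : dot u (- v) = - dot u v.
Proof. by rewrite dotC dotNl dotC. Qed.

Lemma dotBr u v w : dot w (u - v) = dot w u - dot w v.
Proof. by rewrite dotDr dotNr. Qed.

Lemma dot0r u : dot u 0 = 0.
Proof. by rewrite -(scale0r (0 : 'rV_m)) dotZr mul0r. Qed.

Lemma dot_ge0 u : 0 <= dot u u.
Proof. by apply: sumr_ge0 => i _; rewrite -expr2 sqr_ge0. Qed.

Lemma coord_sqr_le_dot u i : u 0 i ^+ 2 <= dot u u.
Proof.
rewrite /dot (bigD1 i)//= -expr2 lerDl.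
by apply: sumr_ge0 => j _; rewrite -expr2 sqr_ge0.
Qed.

Lemma coordB_sqr_le_dot u v i : (u 0 i - v 0 i) ^+ 2 <= dot (u - v) (u - v).
Proof. by have := coord_sqr_le_dot (u - v) i; rewrite !mxE. Qed.

Lemma dot_le0_eq0 u : dot u u <= 0 -> u = 0.
Proof.
move=> u0; apply/rowP => i; rewrite mxE.
have := le_trans (coord_sqr_le_dot u i) u0.
by rewrite le_eqVlt ltNge sqr_ge0 orbF sqrf_eq0 => /eqP.
Qed.

Lemma sqr_norm2 u : norm2 u ^+ 2 = dot u u.
Proof.
rewrite /norm2 sqr_sqrtr; last by apply: sumr_ge0 => i _; rewrite sqr_ge0.
by apply: eq_bigr => i _; rewrite expr2.
Qed.

Lemma norm2_ge0 u : 0 <= norm2 u.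
Proof. exact: sqrtr_ge0. Qed.

(** Young's inequality: it stands in for Cauchy-Schwarz, so that only squared
    norms ever have to be estimated. *)
Lemma young_dot a u v : 0 < a ->
  dot u v <= a / 2 * dot u u + (a * 2)^-1 * dot v v.
Proof.
move=> a0.
have := dot_ge0 (a *: u - v).
rewrite dotBl !dotBr !dotZl !dotZr (dotC v u) => h.
rewrite -(ler_pM2r (_ : 0 < a * 2)) ?mulr_gt0//.
have -> : (a / 2 * dot u u + (a * 2)^-1 * dot v v) * (a * 2) =
   a * (a * dot u u) + dot v v by field; apply/lt0r_neq0.
lra.
Qed.

End InnerProduct.

Lemma ler_norm2 {R : realType} m k (a : R) (u : 'rV[R]_m) (w : 'rV[R]_k) : 0 <= a ->
  (a * norm2 u <= norm2 w) = (a ^+ 2 * dot u u <= dot w w).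
Proof.
move=> a0; rewrite -!sqr_norm2 -exprMn ler_pXn2r// nnegrE ?norm2_ge0//.
by rewrite mulr_ge0 ?norm2_ge0.
Qed.


Section Lines.
Context {R : realType}.

(** The difference quotients of a function along a line are those of its
    restriction to the line, so multivariate derivatives can be handled by
    one-variable calculus. *)
Lemma is_derive_line (V W : normedModType R) (f : V -> W) x v t :
  derivable f (x + t *: v) v ->
  is_derive t 1 (fun s => f (x + s *: v)) ('D_v f (x + t *: v)).
Proof.
have E : (fun h : R => h^-1 *: (((fun s => f (x + s *: v)) \o shift t) (h *: 1)
            - f (x + t *: v))) =
         (fun h : R => h^-1 *: ((f \o shift (x + t *: v)) (h *: v)
            - f (x + t *: v))).
  apply/funext => h /=; congr (_ *: (f _ - _)).
  by rewrite [h *: 1]mulr1 scalerDl addrCA.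
by move=> df; split; [rewrite /derivable E | rewrite /derive E].
Qed.

Context {n : nat}.
Implicit Types (f : 'rV[R]_n -> R) (x v : 'rV[R]_n).

Lemma derive_grad f x v : differentiable f x -> 'D_v f x = dot (grad f x) v.
Proof.
move=> df; rewrite deriveE// {1}(row_sum_delta v) linear_sum.
apply: eq_bigr => i _; rewrite linearZ mxE deriveE//=; first by rewrite mulrC.
Qed.

Lemma is_derive_f_line f x v (t : R) : differentiable f (x + t *: v) ->
  is_derive t 1 (fun s => f (x + s *: v)) (dot (grad f (x + t *: v)) v).
Proof.
by move=> df; rewrite -derive_grad//; apply/is_derive_line/diff_derivable.
Qed.

Lemma is_derive_grad_line f x v (t : R) : differentiable (grad f) (x + t *: v) ->
  is_derive t 1 (fun s => dot (grad f (x + s *: v)) v)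
    (quad (hess f (x + t *: v)) v).
Proof.
move=> dg.
have dgv : derivable (grad f) (x + t *: v) v by exact: diff_derivable.
have dgi i : is_derive t 1 (v 0 i \*: (fun s => grad f (x + s *: v) 0 i))
    (v 0 i *: 'D_v (fun y => grad f y 0 i) (x + t *: v)).
  by apply: is_deriveZ; apply: is_derive_line; apply: (derivable_mxP _ _ _).1.
have := is_derive_sum dgi.
rewrite (_ : \sum_i _ = fun s => dot (grad f (x + s *: v)) v); last first.
  by apply/funext => s; rewrite fct_sumE; apply: eq_bigr => i _; rewrite mulrC.
move/is_derive_eq; apply; apply: eq_bigr => i _.
by rewrite /hess -deriveEjacobian// derive_mx// mxE mulrC.
Qed.

Lemma derive_neg_decrease (h : R -> R) (a : R) : is_derive (0 : R) (1 : R) h a -> a < 0 ->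
  exists2 e : R, 0 < e & forall t, 0 < t < e -> h t < h 0.
Proof.
move=> dh a0.
have : derive1 h 0 = a by rewrite derive1E derive_val.
rewrite /derive1 => ha.
have : (fun t : R => t^-1 *: (h (t + 0) - h 0)) @ 0^' --> a.
  rewrite -ha; have [+ _] := dh; rewrite /derivable.
  by under [X in cvg (X @ _)]eq_fun do rewrite /= [_ *: 1]mulr1.
move=> /cvgr_lt /(_ 0 a0) /nbhs_ballP [e /= e0 He].
exists e => // t /andP[t0 te].
have := He t; rewrite /ball /= sub0r normrN gtr0_norm// => /(_ te).
rewrite gt_eqF// => /(_ isT); rewrite /= addr0 => H.
have : t^-1 * (h t - h 0) < 0 by exact: H.
by rewrite pmulr_rlt0 ?invr_gt0// subr_lt0.
Qed.

Lemma continuous_line f x v : (forall y, differentiable f y) ->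
  continuous (fun s : R => f (x + s *: v)).
Proof.
move=> df s; apply/differentiable_continuous/derivable1_diffP.
by have [] := is_derive_f_line (df (x + s *: v)).
Qed.

End Lines.

(** * Convexity and sufficient decrease *)

Section Convexity.
Context {R : realType} {n : nat}.
Variables (f : 'rV[R]_n -> R) (lambda : R).
Hypothesis fconvex : convex_function [set: 'rV[R]_n] f.
Hypothesis fdiff : forall x, differentiable f x.
Hypothesis lambda_gt0 : 0 < lambda.
Implicit Types (x y d s : 'rV[R]_n) (t : R).
Local Notation F := (objective f lambda).

(** Convexity with weights bundled in a type, rephrased for real weights. *)
Lemma convex_segment x y t : 0 <= t <= 1 ->
  f (x + t *: (y - x)) <= f x + t * (f y - f x).
Proof.
move=> t01.
have t01' : Itv.spec (@Itv.num_sem R) (Itv.Real `[0%Z, 1%Z]) t.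
  by rewrite /= /Itv.num_sem /= num_real /= in_itv/=.
have := fconvex (Itv.Def t01') (in_setT y) (in_setT x).
change (f (t *: y + (1 - t) *: x) <= t * f y + (1 - t) * f x ->
  f (x + t *: (y - x)) <= f x + t * (f y - f x)).
have -> : t *: y + (1 - t) *: x = x + t *: (y - x).
  by rewrite scalerBr scalerBl scale1r addrC addrAC addrA.
by move=> /le_trans; apply; lra.
Qed.

(** Otherwise the chord minus [f] would have negative slope at [x], and [f]
    would rise above its chord just after [x]. *)
Lemma convex_above_tangent x y : f x + dot (grad f x) (y - x) <= f y.
Proof.
rewrite leNgt; apply/negP => fy.
pose c := f y - f x.
have dh : is_derive (0 : R) (1 : R) (fun t : R => t * c - f (x + t *: (y - x)))
    (c - dot (grad f x) (y - x)).
  have := is_derive_f_line (fdiff (x + 0 *: (y - x))).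
  rewrite scale0r addr0 => df.
  have dc : is_derive (0 : R) (1 : R) (fun t : R => t * c) c.
    rewrite (_ : (fun _ => _) = c \*: id); last first.
      by apply/funext => t /=; rewrite mulrC.
    by apply: is_derive_eq; rewrite /= [_ *: _]mulr1.
  exact: is_deriveB.
have slope_lt0 : c - dot (grad f x) (y - x) < 0 by rewrite /c; lra.
have [e e0 He] := derive_neg_decrease dh slope_lt0.
pose t := Num.min (e / 2) 1.
have t0 : 0 < t by rewrite lt_min divr_gt0//=.
have te : t < e by rewrite gt_min ltr_pdivrMr// mulr2n mulrDr mulr1 ltrDl e0.
have t1 : t <= 1 by rewrite ge_min lexx orbT.
have := He t; rewrite t0 te mul0r scale0r addr0 => /(_ isT).
have := @convex_segment x y t; rewrite (ltW t0) t1 -/c => /(_ isT); lra.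
Qed.

Lemma norm1_segment x y t : 0 <= t <= 1 ->
  norm1 (x + t *: (y - x)) <= norm1 x + t * (norm1 y - norm1 x).
Proof.
move=> /andP[t0 t1]; rewrite /norm1.
rewrite mulrBr addrA [leRHS]addrAC -{1}[\sum_i `|x 0 i|]mul1r -mulrBl.
rewrite !mulr_sumr -big_split ler_sum// => i _; rewrite !mxE.
have -> : x 0 i + t * (y 0 i - x 0 i) = (1 - t) * x 0 i + t * y 0 i by lra.
apply: le_trans (ler_normD _ _) _.
by rewrite !normrM (ger0_norm t0) ger0_norm// subr_ge0.
Qed.

Lemma objective_segment x y t : 0 <= t <= 1 ->
  F (x + t *: (y - x)) <= F x + t * (F y - F x).
Proof.
move=> t01; rewrite /objective.
have := convex_segment x y t01.
have := norm1_segment x y t01; rewrite -(ler_pM2l lambda_gt0); lra.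
Qed.

(** [sign_for s x] says that [s] is a subgradient of the l1-norm at [x].  When
    it holds at both ends of a segment with the same [s], the objective differs
    on the segment from [f] by the linear function [lambda *: s]. *)
Definition sign_for s x := forall i, `|s 0 i| <= 1 /\ `|x 0 i| = s 0 i * x 0 i.

Lemma sign_for_norm1 s x : sign_for s x -> norm1 x = dot s x.
Proof. by move=> sx; apply: eq_bigr => i _; have [_ ->] := sx i. Qed.

(** The absolute value is convex and bounds [s * _] from above, so equality at
    the ends of a segment propagates to its points. *)
Lemma sign_for_segment s x d t u : sign_for s x -> sign_for s (x + t *: d) ->
  0 <= u <= t -> sign_for s (x + u *: d).
Proof.
move=> sx sxd /andP[u0 ut] i.
have [s1 ex] := sx i; have [_] := sxd i; rewrite !mxE => exd; split=> //.
have [t0|t0] := leP t 0.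
  have -> : u = 0 by apply: le_anti; rewrite u0 (le_trans ut).
  by rewrite mul0r addr0.
apply: le_anti; apply/andP; split; last first.
  rewrite -[leRHS]mul1r; apply: le_trans (ler_norm _) _.
  by rewrite normrM ler_wpM2r.
rewrite -(ler_pM2l t0) -{1}(gtr0_norm t0) -normrM.
have -> : t * (x 0 i + u * d 0 i) =
  (t - u) * x 0 i + u * (x 0 i + t * d 0 i) by ring.
apply: le_trans (ler_normD _ _) _.
by rewrite !normrM ex exd (ger0_norm u0) ger0_norm ?subr_ge0//; lra.
Qed.

Lemma objective_sign_for s x : sign_for s x -> F x = f x + lambda * dot s x.
Proof. by move=> sx; rewrite /objective (sign_for_norm1 sx). Qed.

Lemma objective_small_decrease s x d t : 0 < t ->
  sign_for s x -> sign_for s (x + t *: d) ->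
  dot (grad f x + lambda *: s) d < 0 ->
  exists2 u, 0 < u <= t & F (x + u *: d) < F x.
Proof.
move=> t0 sx sxd; set a := dot _ _ => a0.
have dh : is_derive (0 : R) (1 : R)
    (fun u : R => f (x + u *: d) + u * (lambda * dot s d)) a.
  have := is_derive_f_line (fdiff (x + 0 *: d)).
  rewrite scale0r addr0 => df.
  have dc : is_derive (0 : R) (1 : R) (fun t : R => t * (lambda * dot s d))
      (lambda * dot s d).
    rewrite (_ : (fun _ => _) = (lambda * dot s d) \*: id); last first.
      by apply/funext => u /=; rewrite mulrC.
    by apply: is_derive_eq; rewrite /= [_ *: _]mulr1.
  by rewrite /a dotDl dotZl; exact: is_deriveD.
have [e e0 He] := derive_neg_decrease dh a0.
exists (Num.min (e / 2) t).
  by rewrite lt_min divr_gt0//= t0 ge_min lexx orbT.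
set u := Num.min _ _.
have u0 : 0 < u by rewrite lt_min divr_gt0//=.
have ue : u < e by rewrite gt_min ltr_pdivrMr// mulr2n mulrDr mulr1 ltrDl e0.
have ut : u <= t by rewrite ge_min lexx orbT.
have := He u; rewrite u0 ue mul0r scale0r !addr0 => /(_ isT).
have sxu : sign_for s (x + u *: d).
  by apply: sign_for_segment sx sxd _; rewrite (ltW u0).
rewrite (objective_sign_for sx) (objective_sign_for sxu) dotDr dotZr.
by lra.
Qed.

Lemma minimizer_slope_ge0 s x d t : minimizer F x -> 0 < t ->
  sign_for s x -> sign_for s (x + t *: d) ->
  0 <= dot (grad f x + lambda *: s) d.
Proof.
move=> xmin t0 sx sxd; rewrite leNgt; apply/negP => a0.
have [u _] := objective_small_decrease t0 sx sxd a0.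
by rewrite ltNge xmin.
Qed.

Section Level.
Variables (x0 : 'rV[R]_n) (L : R).
Hypothesis L_gt0 : 0 < L.
Local Notation level := (level_set f lambda x0).
Hypothesis glip : forall x y, level x -> level y ->
  dot (grad f x - grad f y) (grad f x - grad f y)
    <= L ^+ 2 * dot (x - y) (x - y).

(** A step of length at most [(1 - eta) * - slope / (L * |d|^2)] satisfies the
    Armijo condition.  At points of the level set this follows from convexity
    and the Lipschitz bound.  Leaving the level set would mean, by the
    intermediate value theorem, a shorter step with no decrease at all, which
    that estimate excludes. *)
Lemma armijo_short_step s x d t eta :
    0 < eta < 1 -> level x -> 0 < t ->
    sign_for s x -> sign_for s (x + t *: d) ->
    let slope := dot (grad f x + lambda *: s) d in
    slope < 0 -> L * dot d d * t <= (1 - eta) * - slope ->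
  F (x + t *: d) <= F x + eta * t * slope.
Proof.
move=> /andP[eta0 eta1] lx t0 sx sxd slope slope0 ht.
have key u : 0 < u -> u <= t -> level (x + u *: d) ->
    F (x + u *: d) <= F x + eta * u * slope.
  move=> u0 ut lu.
  have sxu : sign_for s (x + u *: d).
    by apply: sign_for_segment sx sxd _; rewrite (ltW u0).
  rewrite (objective_sign_for sx) (objective_sign_for sxu) dotDr dotZr.
  have := convex_above_tangent (x + u *: d) x.
  rewrite opprD addNKr dotNr dotZr.
  have := glip lu lx; rewrite addrAC subrr add0r dotZl dotZr => hL.
  have Lu0 : 0 < (L * u)^-1 by rewrite invr_gt0 mulr_gt0.
  have := young_dot (grad f (x + u *: d) - grad f x) d Lu0.
  move: hL; set D := dot (_ - _) (_ - _) => hL.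
  have -> : ((L * u)^-1 * 2)^-1 = L * u / 2.
    by field; rewrite !lt0r_neq0.
  have : (L * u)^-1 / 2 * D <= L * u / 2 * dot d d.
    rewrite -(ler_pM2l (_ : 0 < 2 * (L * u))) ?mulr_gt0//.
    have -> : 2 * (L * u) * ((L * u)^-1 / 2 * D) = D.
      by field; rewrite !lt0r_neq0.
    by apply: le_trans hL _; lra.
  rewrite dotBl => h1 h2 h3.
  have : L * dot d d * u <= (1 - eta) * - slope.
    apply: le_trans ht; rewrite ler_wpM2l// mulr_ge0 ?dot_ge0//; exact: ltW.
  move=> h4.
  have h5 : dot (grad f (x + u *: d)) d <=
     dot (grad f x) d + (1 - eta) * - slope by lra.
  have : u * dot (grad f (x + u *: d)) d <=
     u * (dot (grad f x) d + (1 - eta) * - slope) by rewrite ler_wpM2l// ltW.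
  move: h3 h5; rewrite /slope dotDl dotZl; lra.
have [Ft|] := boolP (F (x + t *: d) <= F x).
  exact: (key t t0 (lexx t) (le_trans Ft lx)).
rewrite -ltNge => Ft.
have [v /andP[v0 vt] Fv] := objective_small_decrease t0 sx sxd slope0.
pose G u := f (x + u *: d) + lambda * (dot s x + u * dot s d).
have GE u : 0 <= u <= t -> F (x + u *: d) = G u.
  move=> ut; rewrite (objective_sign_for (sign_for_segment sx sxd ut)).
  by rewrite /G dotDr dotZr.
have Gc : continuous G.
  move=> u; apply: cvgD; first exact: continuous_line.
  apply: cvgMl_tmp; apply: cvgD; first exact: cvg_cst.
  by apply: cvgMr_tmp; exact: cvg_id.
(* Between [v], where F is below F x, and t, where it is above, it equals F x
   at a point of the level set. *)
have [] := @IVT _ G v t (F x) vt.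
- by apply: continuous_subspaceT.
- rewrite -!GE ?(ltW t0) ?lexx ?(ltW v0) ?vt//.
  by rewrite ge_min (ltW Fv)/= le_max (ltW Ft) orbT.
move=> u; rewrite in_itv/= => /andP[vu ut].
rewrite -GE; last by rewrite ut (le_trans _ vu)// ltW.
move=> Fu; have u0 : 0 < u := lt_le_trans v0 vu.
have := key u u0 ut; rewrite /level_set /= Fu => /(_ lx).
have : eta * u * slope < 0 by rewrite pmulr_rlt0// mulr_gt0.
by move=> h1 h2; exfalso; lra.
Qed.

End Level.

End Convexity.

(** * Quadratic growth *)

Section Growth.
Context {R : realType} {n : nat}.
Variables (f : 'rV[R]_n -> R) (lambda : R) (x0 : 'rV[R]_n).
Hypothesis fconvex : convex_function [set: 'rV[R]_n] f.
Hypothesis fC2 : twice_continuously_differentiable f.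
Hypothesis lambda_gt0 : 0 < lambda.
Variable theta : R.
Hypothesis theta_ge0 : 0 <= theta.
Hypothesis hess_lb : forall x v, level_set f lambda x0 x ->
  theta * dot v v <= quad (hess f x) v.
Local Notation F := (objective f lambda).

(** Strong convexity, compared at the quarter points of the segment from the
    minimizer [z] to [x]: writing [h] for the restriction of [f] to it,
    [h 1 - h (3/4) - h (1/4) + h 0] is a quarter of the difference of two
    values of [h'] at abscissas at least [1/2] apart. *)
Lemma quadratic_growth z x : minimizer F z -> level_set f lambda x0 x ->
  theta / 8 * dot (x - z) (x - z) <= F x - F z.
Proof.
move=> zmin lx; have [fdiff gdiff _] := fC2.
set v := x - z.
have lev t : 0 <= t <= 1 -> level_set f lambda x0 (z + t *: v).
  move=> /andP[t0 t1]; have := @objective_segment _ _ _ _ fconvex lambda_gt0 z x t.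
  rewrite t0 t1 => /(_ isT) /le_trans; apply.
  apply: le_trans _ lx; have := zmin x.
  rewrite -subr_ge0 => zx.
  have : t * (F x - F z) <= 1 * (F x - F z) by rewrite ler_wpM2r.
  lra.
(* The l1-norm enters only through its convexity, at the end of the proof. *)
pose h t := f (z + t *: v).
pose h' t := dot (grad f (z + t *: v)) v.
have hc : continuous h by exact: continuous_line.
have dh (t : R) : is_derive t (1 : R) h (h' t) by exact: is_derive_f_line.
have dh' (t : R) : is_derive t (1 : R) h' (quad (hess f (z + t *: v)) v).
  exact: is_derive_grad_line.
have hc' : continuous h'.
  move=> t; apply/differentiable_continuous/derivable1_diffP.
  by have [] := dh' t.
have [||a /itvP aI ha] := @MVT _ h h' 0 (1/4); first lra.
  exact: continuous_subspaceT.
have [||b /itvP bI hb] := @MVT _ h h' (3/4) 1; first lra.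
  exact: continuous_subspaceT.
have a0 : 0 < a by rewrite aI.
have a1 : a < 1/4 by rewrite aI.
have b0 : 3/4 < b by rewrite bI.
have b1 : b < 1 by rewrite bI.
have [||c] := @MVT _ h' (fun t => quad (hess f (z + t *: v)) v) a b; first lra.
  exact: continuous_subspaceT.
rewrite in_itv/= => /andP[ac cb] hab.
have /hess_lb hq : level_set f lambda x0 (z + c *: v) by apply: lev; lra.
have hh : theta * dot v v * (b - a) <= h' b - h' a.
  by rewrite hab ler_wpM2r//; lra.
have hF t : 0 <= t <= 1 -> F z <= h t + lambda * (norm1 z + t * (norm1 x - norm1 z)).
  move=> t01; apply: le_trans (zmin (z + t *: v)) _.
  by rewrite lerD2l ler_pM2l// norm1_segment.
have h14 : F z <= h (1/4) + lambda * (norm1 z + 1/4 * (norm1 x - norm1 z)).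
  by apply: hF; lra.
have h34 : F z <= h (3/4) + lambda * (norm1 z + 3/4 * (norm1 x - norm1 z)).
  by apply: hF; lra.
have -> : F x = h 1 + lambda * norm1 x.
  by rewrite /objective /h scale1r /v subrKC.
have Fz : F z = h 0 + lambda * norm1 z by rewrite /h scale0r addr0.
have : theta * dot v v * (1 / 2) <= theta * dot v v * (b - a).
  by rewrite ler_wpM2l ?mulr_ge0 ?dot_ge0//; lra.
move: ha hb Fz hh h34 h14.
by lra.
Qed.

End Growth.

(** * The residuals phi and beta *)

Section Residuals.
Context {R : realType}.
Implicit Types (lambda x z g e : R).

Definition phi_coord lambda x g : R :=
  if x == 0 then 0
  else if (0 < x) && (0 < g + lambda) then
    Num.min (g + lambda) (Num.max x (g - lambda))
  else if (x < 0) && (g - lambda < 0) then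
    Num.max (g - lambda) (Num.min x (g + lambda))
  else g + lambda * Num.sg x.

Definition beta_coord lambda x g : R :=
  if x == 0 then
    if g + lambda < 0 then g + lambda
    else if 0 < g - lambda then g - lambda
    else 0
  else 0.

(** Oddness halves the case analyses below: a negative coordinate reduces to a
    positive one. *)
Lemma phi_coordN lambda x g :
  phi_coord lambda (- x) (- g) = - phi_coord lambda x g.
Proof.
rewrite /phi_coord oppr_eq0 !oppr_gt0 !oppr_lt0.
have -> : (0 < - g + lambda) = (g - lambda < 0) by rewrite -oppr_gt0 opprB addrC.
have -> : (- g - lambda < 0) = (0 < g + lambda) by rewrite -opprD oppr_lt0.
have -> : - g + lambda = - (g - lambda) by rewrite opprB addrC.
rewrite -opprD.
case: (ltgtP x 0) => [x0|x0|x0]; rewrite ?oppr0 //= ?andbF ?andbT.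
- case: ifP => _; first by rewrite -oppr_min -oppr_max.
  by rewrite sgrN; lra.
- case: ifP => _; first by rewrite -oppr_max -oppr_min.
  by rewrite sgrN; lra.
Qed.

Lemma beta_coordN lambda x g : 0 < lambda ->
  beta_coord lambda (- x) (- g) = - beta_coord lambda x g.
Proof.
move=> l0; rewrite /beta_coord oppr_eq0.
by repeat (case: ifP => ?); lra.
Qed.

(** The truncation in [phi] is turned into inequalities once and for all;
    negative coordinates follow by oddness. *)
Lemma phi_coord_gt0 lambda x g : 0 < lambda -> 0 < x ->
  let p := phi_coord lambda x g in
  (p = g + lambda /\ (p <= 0 \/ (p <= x \/ p <= g - lambda))) \/
  [/\ x <= p, g - lambda <= p, p <= g + lambda & p = x \/ p = g - lambda].
Proof.
move=> l0 x0; rewrite /phi_coord gt_eqF// x0 (lt_gtF x0)/= gtr0_sg// mulr1.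
have [gl|gl] := ltP 0 (g + lambda); last by left; split=> //; left.
have [h1|h1] := leP x (g - lambda).
  have [h2|h2] := leP (g + lambda) (g - lambda).
    by left; split=> //; right; right.
  by right; split; first [lra | right].
have [h2|h2] := leP (g + lambda) x.
  by left; split=> //; right; left.
by right; split; first [lra | left].
Qed.

Lemma sign_cases (P : R -> R -> R -> Prop) :
  (forall x z g, P (- x) (- z) (- g) -> P x z g) ->
  (forall z g, P 0 z g) -> (forall x z g, 0 < x -> P x z g) ->
  forall x z g, P x z g.
Proof.
move=> PN P0 Ppos x z g; have [x0|x0|->] := ltgtP x 0 => //; last exact: Ppos.
by apply: PN; apply: Ppos; rewrite oppr_gt0.
Qed.

Lemma phi_coord_le lambda x g : 0 < lambda -> x != 0 ->
  `|phi_coord lambda x g| <= `|g + lambda * Num.sg x|.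
Proof.
move=> l0; have pos y h : 0 < y -> `|phi_coord lambda y h| <= `|h + lambda * Num.sg y|.
  move=> y0; rewrite gtr0_sg// mulr1.
  have [[-> _]//|[h1 h2 h3 _]] := phi_coord_gt0 h l0 y0.
  by rewrite !ger0_norm//; lra.
rewrite neq_lt => /orP[x0|/pos//].
have := pos (- x) (- g); rewrite oppr_gt0 => /(_ x0).
by rewrite phi_coordN sgrN mulrN -opprD !normrN.
Qed.

(** Off the zero set [g + lambda * sgn x] may stay large although [phi] is
    small; then [x] itself is small and [g] exceeds the interval
    [[- lambda, lambda]] by little, so the coordinate still contributes little
    to the objective gap. *)
Lemma coord_gap_le lambda C x z g : 0 < lambda ->
  `|x - z| <= C -> `|z| <= C -> `|g| + lambda <= C ->
  g * (x - z) + lambda * (`|x| - `|z|) <=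
    2 * C * `|phi_coord lambda x g| + C * `|beta_coord lambda x g|.
Proof.
move=> l0; move: x z g.
apply: sign_cases => [x z g h| z g|x z g x0].
- have <- : `|- x - - z| = `|x - z| by rewrite -opprD normrN.
  move: h; rewrite phi_coordN beta_coordN// !normrN => h.
  move=> h1 h2 h3; apply: le_trans (h h1 h2 h3).
  by rewrite -opprD mulrNN.
- rewrite /phi_coord /beta_coord eqxx normr0 mulr0 !add0r => _ zC _.
  rewrite !mulrN -opprD.
  have key (b : R) : 0 <= b -> - (g * z + lambda * `|z|) <= b * `|z| ->
      - (g * z + lambda * `|z|) <= C * b.
    move=> b0 /le_trans; apply; rewrite mulrC; exact: ler_wpM2r.
  have nz := normr_ge0 z.
  have gz : - (g * z) <= `|g| * `|z| by rewrite -normrM -normrN ler_norm.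
  case: ifP => [gl|gl].
    apply: key => //.
    have -> : `|g + lambda| = - (g + lambda) by rewrite ltr0_norm.
    have g0 : `|g| = - g by rewrite ltr0_norm//; lra.
    by rewrite g0 in gz; lra.
  case: ifP => [gl'|gl'].
    apply: key => //.
    have -> : `|g - lambda| = g - lambda by rewrite gtr0_norm.
    have g0 : `|g| = g by rewrite gtr0_norm//; lra.
    by rewrite g0 in gz; lra.
  apply: key; first by [].
  rewrite normr0 mul0r.
  have : `|g| <= lambda by rewrite ler_norml; apply/andP; split; lra.
  move=> /(ler_wpM2r nz); lra.
- have -> : beta_coord lambda x g = 0 by rewrite /beta_coord gt_eqF.
  rewrite normr0 mulr0 addr0 (gtr0_norm x0) => xz zC gC.
  have C0 : 0 <= C by apply: le_trans zC.
  have zl : lambda * z <= lambda * `|z| by rewrite ler_pM2l// ler_norm.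
  have := phi_coord_gt0 g l0 x0.
  set p := phi_coord _ _ _ => -[[pE _]|[h1 h2 h3 _]].
    have h : p * (x - z) <= `|p| * C.
      apply: le_trans (ler_norm _) _; rewrite normrM; exact: ler_wpM2l.
    have : 0 <= `|p| * C by rewrite mulr_ge0.
    by rewrite pE in h *; lra.
  have p0 : 0 < p by lra.
  rewrite (gtr0_norm p0).
  have gn := ler_norm g.
  have : (g + lambda) * x <= C * p by apply: ler_pM; lra.
  have : - (g * z) - lambda * `|z| <= C * p.
    have [z0|z0] := leP 0 z.
      rewrite (ger0_norm z0).
      have : 0 <= (g + lambda) * z by rewrite mulr_ge0//; lra.
      have : 0 <= C * p by rewrite mulr_ge0// ltW.
      lra.
    rewrite (ltr0_norm z0) in zC *.
    have : (g - lambda) * - z <= p * C.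
      apply: (@le_trans _ _ (p * - z)); first by rewrite ler_wpM2r//; lra.
      by rewrite ler_wpM2l//; lra.
    lra.
  lra.
Qed.

(** [phi] and [beta] are discontinuous in general but continuous at a solution:
    a coordinate that enters or leaves zero makes them jump only where the
    optimality conditions fail. *)
Lemma coord_residual_small lambda z gz e : 0 < lambda -> 0 < e ->
  (0 < z -> gz = - lambda) -> (z < 0 -> gz = lambda) -> `|gz| <= lambda ->
  exists2 del : R, 0 < del & forall x g,
    `|x - z| < del -> `|g - gz| < del ->
    `|phi_coord lambda x g| < e /\ `|beta_coord lambda x g| < e.
Proof.
move=> l0 e0 zpos zneg zz.
exists (if z == 0 then e else Num.min e `|z|).
  by case: ifP => // /negbT z0; rewrite lt_min e0 normr_gt0.
move=> x g; set del := (if _ then _ else _) => xz ggz.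
have de : del <= e by rewrite /del; case: ifP => // _; rewrite ge_min lexx.
have dz : z != 0 -> del <= `|z|.
  by rewrite /del; case: ifP => // _ _; rewrite ge_min lexx orbT.
move: zz; rewrite ler_norml => /andP[gz1 gz2].
clearbody del; move: x z g gz gz1 gz2 xz ggz zpos zneg dz.
suff pos x z g gz : 0 < x ->
    - lambda <= gz -> gz <= lambda -> `|x - z| < del -> `|g - gz| < del ->
    (0 < z -> gz = - lambda) -> (z < 0 -> gz = lambda) ->
    (z != 0 -> del <= `|z|) ->
    `|phi_coord lambda x g| < e /\ `|beta_coord lambda x g| < e.
  move=> x z g gz gz1 gz2 xz ggz zpos zneg dz.
  have [x0|x0|x0] := ltgtP x 0; last 1 first.
  - have z0 : z = 0.
      apply/eqP; case: eqP => // /eqP /dz.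
      by rewrite leNgt; move: xz; rewrite x0 sub0r normrN => ->.
    move: ggz; rewrite ltr_norml => /andP[g1 g2].
    rewrite /phi_coord /beta_coord x0 eqxx normr0; split=> //.
    case: ifP => ?; first by rewrite ltr0_norm//; lra.
    case: ifP => ?; first by rewrite gtr0_norm//; lra.
    by rewrite normr0.
  - rewrite -[`|phi_coord _ _ _|]normrN -[`|beta_coord _ _ _|]normrN.
    rewrite -phi_coordN -beta_coordN//.
    apply: (pos _ (- z) _ (- gz)); rewrite ?oppr_gt0 ?oppr_lt0 ?oppr_eq0 ?normrN//.
    + by lra.
    + by lra.
    + by rewrite -opprD normrN.
    + by rewrite -opprD normrN.
    + by move=> /zneg ->.
    + by move=> /zpos ->; rewrite opprK.
  - exact: (pos x z g gz).
move=> x0 gz1 gz2 xz ggz zpos zneg dz; split; last first.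
  by rewrite /beta_coord gt_eqF// normr0.
move: ggz; rewrite ltr_norml => /andP[g1 g2].
have z0 : 0 <= z.
  rewrite leNgt; apply/negP => z0; have := dz (ltr0_neq0 z0).
  by rewrite ltr0_norm// leNgt => /negP; apply; move: xz; rewrite gtr0_norm; lra.
move: xz; rewrite ltr_norml => /andP[x1 x2].
move: z0; rewrite le_eqVlt => /orP[/eqP z0|/[dup] z0 /zpos gzE]; last first.
  have := phi_coord_gt0 g l0 x0.
  case=> [[-> _]|[h1 h2 h3 _]]; rewrite ltr_norml; apply/andP; split; lra.
subst z.
have := phi_coord_gt0 g l0 x0.
case=> [[-> []]|[h1 h2 h3 [] pE]].
- by move=> ?; rewrite ltr_norml; apply/andP; split; lra.
- by move=> [] ?; rewrite ltr_norml; apply/andP; split; lra.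
- by rewrite pE gtr0_norm//; lra.
- by rewrite pE in h1 *; rewrite ltr_norml; apply/andP; split; lra.
Qed.

End Residuals.

Section Optimality.
Context {R : realType} {n : nat}.
Variables (f : 'rV[R]_n -> R) (lambda : R).
Hypothesis fconvex : convex_function [set: 'rV[R]_n] f.
Hypothesis fdiff : forall x, differentiable f x.
Hypothesis lambda_gt0 : 0 < lambda.
Implicit Types (x z : 'rV[R]_n).
Local Notation F := (objective f lambda).

Lemma phiE x i : phi f lambda x 0 i = phi_coord lambda (x 0 i) (grad f x 0 i).
Proof. by rewrite /phi_coord !mxE. Qed.

Lemma betaE x i : beta f lambda x 0 i = beta_coord lambda (x 0 i) (grad f x 0 i).
Proof. by rewrite /beta_coord !mxE. Qed.

(** First-order optimality along the [i]-th axis: [c] is the sign of the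
    direction and [s] a slope of the absolute value valid on the step. *)
Lemma minimizer_coord z i (c s t : R) : minimizer F z -> 0 < t ->
  `|s| <= 1 -> `|z 0 i| = s * z 0 i -> `|z 0 i + t * c| = s * (z 0 i + t * c) ->
  0 <= (grad f z 0 i + lambda * s) * c.
Proof.
move=> zmin t0 s1 zs zts.
pose sv : 'rV[R]_n := \row_j if j == i then s else Num.sg (z 0 j).
have sgP j : `|Num.sg (z 0 j)| <= 1 /\ `|z 0 j| = Num.sg (z 0 j) * z 0 j.
  by split; [rewrite normr_sg; case: (_ != _) | rewrite normrEsg].
have sz : sign_for sv z.
  by move=> j; rewrite mxE; case: eqP => [->|_].
have szt : sign_for sv (z + t *: (c *: delta_mx 0 i)).
  move=> j; rewrite !mxE eqxx /=; case: eqP => [->|_]; first by rewrite mulr1.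
  by rewrite !mulr0 addr0.
have := minimizer_slope_ge0 fdiff zmin t0 sz szt.
rewrite /dot (bigD1 i)//= big1 => [|j ji]; rewrite !mxE ?eqxx /=.
  by rewrite ?eqxx mulr1 addr0.
by rewrite (negbTE ji) !mulr0.
Qed.

(** At a nonzero coordinate both directions are tried with the sign of the
    coordinate; the inward step has length [|z i|], which ends at zero. *)
Lemma minimizer_grad z i : minimizer F z ->
  [/\ 0 < z 0 i -> grad f z 0 i = - lambda,
      z 0 i < 0 -> grad f z 0 i = lambda & `|grad f z 0 i| <= lambda].
Proof.
move=> zmin.
have pos : 0 < z 0 i -> grad f z 0 i = - lambda.
  move=> z0.
  have := @minimizer_coord z i 1 1 1 zmin ltr01.
  have := @minimizer_coord z i (-1) 1 (z 0 i) zmin z0.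
  rewrite !mul1r !mulr1 mulrN1 subrr normr0 normr1 lexx !gtr0_norm//; last by lra.
  by move=> /(_ isT erefl erefl) + /(_ isT erefl erefl); lra.
have neg : z 0 i < 0 -> grad f z 0 i = lambda.
  move=> z0; have z0' : 0 < - z 0 i by rewrite oppr_gt0.
  have := @minimizer_coord z i (-1) (-1) 1 zmin ltr01.
  have := @minimizer_coord z i 1 (-1) (- z 0 i) zmin z0'.
  rewrite !mulN1r !mulr1 mulrN1 subrr normr0 normrN normr1 lexx oppr0 mul1r.
  rewrite !ltr0_norm//; last by lra.
  by move=> /(_ isT erefl erefl) + /(_ isT erefl erefl); lra.
split=> //; have [z0|z0|z0] := ltgtP (z 0 i) 0.
- by rewrite neg// gtr0_norm.
- by rewrite pos// normrN gtr0_norm.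
have := @minimizer_coord z i 1 1 1 zmin ltr01.
have := @minimizer_coord z i (-1) (-1) 1 zmin ltr01.
rewrite z0 !mulr1 !mulr0 !add0r mulrN1 normrN mulN1r opprK mul1r normr0 normr1 lexx.
move=> /(_ isT erefl erefl) h1 /(_ isT erefl erefl) h2.
by rewrite ler_norml; apply/andP; split; lra.
Qed.

(** The gap is at most a multiple of the l1-norm of the residual.  Young's
    inequality with parameter [a] converts it to the squared norms produced by
    the line searches. *)
Lemma objective_gap_le x z C a : 0 < a ->
  (forall i, [/\ `|x 0 i - z 0 i| <= C, `|z 0 i| <= C
               & `|grad f x 0 i| + lambda <= C]) ->
  F x - F z <= n%:R * a + 4 * C ^+ 2 / a *
    (dot (phi f lambda x) (phi f lambda x) + dot (beta f lambda x) (beta f lambda x)).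
Proof.
move=> a0 hC.
have := convex_above_tangent fconvex fdiff x z => ht.
apply: (@le_trans _ _ (\sum_i (grad f x 0 i * (x 0 i - z 0 i)
    + lambda * (`|x 0 i| - `|z 0 i|)))).
  rewrite big_split/= -mulr_sumr sumrB -/(norm1 x) -/(norm1 z).
  have -> : \sum_i grad f x 0 i * (x 0 i - z 0 i) = - dot (grad f x) (z - x).
    by rewrite /dot -sumrN; apply: eq_bigr => i _; rewrite !mxE; ring.
  by rewrite /objective; lra.
have -> : n%:R * a = \sum_(i < n) a by rewrite sumr_const card_ord mulr_natl.
rewrite -big_split mulr_sumr -big_split ler_sum// => i _ /=.
have [h1 h2 h3] := hC i.
apply: le_trans (coord_gap_le lambda_gt0 h1 h2 h3) _.
rewrite -phiE -betaE -!expr2.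
set p := phi f lambda x 0 i; set b := beta f lambda x 0 i.
rewrite -[p ^+ 2]real_normK ?num_real// -[b ^+ 2]real_normK ?num_real//.
move: `|p| `|b| => {}p {}b.
rewrite -(ler_pM2r a0) mulrDl -mulrA (mulrC _ a) mulrA.
have -> : (a + 4 * C ^+ 2 / a * (p ^+ 2 + b ^+ 2)) * a =
  a ^+ 2 + 4 * C ^+ 2 * (p ^+ 2 + b ^+ 2) by field; apply/lt0r_neq0.
have := sqr_ge0 (a - 2 * C * p).
have := sqr_ge0 (a - C * b).
have := sqr_ge0 (C * p).
have := sqr_ge0 (C * b).
nra.
Qed.

End Optimality.

(** * Subvectors, sign patterns and backtracking *)

Section Subvectors.
Context {R : realType} {n : nat}.
Implicit Types (I : {set 'I_n}) (u w : 'rV[R]_n) (M : 'M[R]_n).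

Definition zero_outside I u : 'rV[R]_n := \row_i if i \in I then u 0 i else 0.

Lemma subvec_zero_outside I u : subvec I (zero_outside I u) = subvec I u.
Proof. by apply/rowP => j; rewrite !mxE enum_valP. Qed.

Lemma subvecZ I (a : R) u : subvec I (a *: u) = a *: subvec I u.
Proof. by apply/rowP => j; rewrite !mxE. Qed.

Lemma subvecN I u : subvec I (- u) = - subvec I u.
Proof. by apply/rowP => j; rewrite !mxE. Qed.

Lemma zero_outside_out I u i : i \notin I -> zero_outside I u 0 i = 0.
Proof. by rewrite mxE => /negbTE ->. Qed.

(** Linear algebra on subvectors is carried out on full vectors that vanish
    outside [I]. *)
Lemma sum_subvec I (G : 'I_n -> R) : (forall i, i \notin I -> G i = 0) ->
  \sum_(j < #|I|) G (enum_val j) = \sum_i G i.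
Proof.
move=> G0; rewrite -big_enum_val [RHS](bigID (mem I))/= [X in _ + X]big1 ?addr0//.
Qed.

Lemma dot_subvec I u w : (forall i, i \notin I -> w 0 i = 0) ->
  dot (subvec I u) (subvec I w) = dot u w.
Proof.
move=> w0; rewrite -[RHS](@sum_subvec I (fun i => u 0 i * w 0 i)); last first.
  by move=> i /w0 ->; rewrite mulr0.
by apply: eq_bigr => j _; rewrite !mxE.
Qed.

Lemma quad_submat I M w : (forall i, i \notin I -> w 0 i = 0) ->
  quad (submat I M) (subvec I w) = quad M w.
Proof.
move=> w0; rewrite /quad -(dot_subvec _ w0); apply: eq_bigr => j _.
rewrite !mxE; congr (_ * _).
rewrite -[RHS](@sum_subvec I (fun i => w 0 i * M i (enum_val j))); last first.
  by move=> i /w0 ->; rewrite mul0r.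
by apply: eq_bigr => k _; rewrite !mxE.
Qed.

Lemma quadZ M (a : R) w : quad M (a *: w) = a ^+ 2 * quad M w.
Proof. by rewrite /quad -scalemxAl dotZl dotZr mulrA. Qed.

End Subvectors.

Section Signs.
Context {R : realType}.
Implicit Types (x d a T : R).

Lemma sgr_line_same x d a : 0 <= a -> x != 0 -> 0 <= x * d ->
  Num.sg (x + a * d) = Num.sg x.
Proof.
move=> a0; rewrite neq_lt => /orP[x0|x0].
  rewrite nmulr_rge0// => d0; rewrite !ltr0_sg//.
  by have := mulr_ge0_le0 a0 d0; lra.
rewrite pmulr_rge0// => d0; rewrite !gtr0_sg//.
by have := mulr_ge0 a0 d0; lra.
Qed.

(** If [d] points from [x] towards zero, zero is reached exactly at
    [|x| / |d|]. *)
Lemma sgr_line_opp x d a : x * d < 0 ->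
  [/\ (Num.sg (x + a * d) == Num.sg x) = (a < `|x| / `|d|),
      a <= `|x| / `|d| -> `|x + a * d| = Num.sg x * (x + a * d)
    & x + `|x| / `|d| * d = 0].
Proof.
have [x0|x0|->] := ltgtP x 0; last by rewrite mul0r ltxx.
  rewrite nmulr_rlt0// => d0.
  rewrite (ltr0_norm x0) (gtr0_norm d0) (ltr0_sg x0) ltr_pdivlMr// ler_pdivlMr//.
  split; last by field; apply/lt0r_neq0.
    have [h|h] := ltP (a * d) (- x); first by rewrite ltr0_sg ?eqxx//; lra.
    apply/negbTE; apply/eqP => e.
    have : x + a * d < 0 by rewrite -sgr_lt0 e; lra.
    lra.
  by move=> h; rewrite mulN1r ler0_norm//; lra.
rewrite pmulr_rlt0// => d0.
rewrite (gtr0_norm x0) (ltr0_norm d0) (gtr0_sg x0) ltr_pdivlMr ?ler_pdivlMr ?oppr_gt0//.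
split; last by field; apply/ltr0_neq0.
  have [h|h] := ltP (a * - d) x; first by rewrite gtr0_sg ?eqxx//; lra.
  apply/negbTE; apply/eqP => e.
  have : 0 < x + a * d by rewrite -sgr_gt0 e; lra.
  lra.
by move=> h; rewrite mul1r ger0_norm//; lra.
Qed.

Context {n : nat}.
Implicit Types (u v : 'rV[R]_n).

Definition nonzeros v : {set 'I_n} := [set i | v 0 i != 0].

Definition dir_in_nonzeros u v := forall i, u 0 i = 0 -> v 0 i = 0.

Lemma sgnvP u v : (sgnv u = sgnv v) <-> (forall i, Num.sg (u 0 i) = Num.sg (v 0 i)).
Proof.
split=> [h i|h]; first by have := congr1 (fun w : 'rV[R]_n => w 0 i) h; rewrite !mxE.
by apply/rowP => i; rewrite !mxE.
Qed.

Lemma sign_for_sgnv u v : sgnv u = sgnv v -> sign_for (sgnv v) u.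
Proof.
move=> /sgnvP h i; rewrite mxE -h; split; last by rewrite normrEsg.
by rewrite normr_sg; case: (_ != _).
Qed.

Lemma sgnv_shorter u v a T : dir_in_nonzeros u v -> 0 <= a <= T ->
  sgnv (u + T *: v) = sgnv u -> sgnv (u + a *: v) = sgnv u.
Proof.
move=> uv /andP[a0 aT] /sgnvP hT; apply/sgnvP => i; have := hT i; rewrite !mxE.
have [u0|u0] := eqVneq (u 0 i) 0; first by rewrite uv// !mulr0.
have [neg|pos] := ltP (u 0 i * v 0 i) 0; last by rewrite (sgr_line_same a0).
have [e1 _ _] := sgr_line_opp T neg; have [e2 _ _] := sgr_line_opp a neg.
by move=> /eqP; rewrite e1 => h; apply/eqP; rewrite e2; apply: le_lt_trans h.
Qed.

Lemma sgnv_small_step u v : dir_in_nonzeros u v ->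
  exists2 e : R, 0 < e & forall a, 0 <= a < e -> sgnv (u + a *: v) = sgnv u.
Proof.
move=> uv.
have : \forall a \near (0 : R), forall i, 0 <= a ->
    Num.sg (u 0 i + a * v 0 i) = Num.sg (u 0 i).
  apply: (@filter_forall R 'I_n (fun i a => 0 <= a ->
    Num.sg (u 0 i + a * v 0 i) = Num.sg (u 0 i)) (nbhs (0 : R))) => i.
  have [u0|u0] := eqVneq (u 0 i) 0.
    by apply: nearW => a _; rewrite uv// mulr0 u0 addr0.
  have [neg|pos] := ltP (u 0 i * v 0 i) 0; last first.
    by apply: nearW => a a0; rewrite sgr_line_same.
  have r0 : 0 < `|u 0 i| / `|v 0 i|.
    rewrite divr_gt0 ?normr_gt0//; apply: contraTneq neg => ->.
    by rewrite mulr0 ltxx.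
  near=> a => a0; apply/eqP; have [-> _ _] := sgr_line_opp a neg.
  by near: a; exact: lt_nbhsl.
move=> /nbhs_ballP[e /= e0 he]; exists e => // a /andP[a0 ae].
apply/sgnvP => i; rewrite !mxE; apply: he => //.
by rewrite /ball/= sub0r normrN ger0_norm.
Unshelve. all: by end_near. Qed.

Lemma sgnv_Proj u v : dir_in_nonzeros u v ->
  (sgnv (Proj v u) == sgnv u) = (sgnv v == sgnv u).
Proof.
move=> uv; apply/eqP/eqP => /sgnvP h; apply/sgnvP => i; have := h i; rewrite !mxE.
  have [u0|u0|u0] := ltgtP (u 0 i) 0; last by rewrite uv// u0.
    rewrite (ltr0_sg u0); case: (leP 0 (v 0 i)) => // v0.
    by rewrite sgr0; lra.
  rewrite (gtr0_sg u0); case: (leP 0 (v 0 i)) => // v0.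
  by rewrite sgr0; lra.
have [u0|u0|u0] := ltgtP (u 0 i) 0; last by rewrite u0.
  rewrite (ltr0_sg u0); case: (leP 0 (v 0 i)) => // v0.
  move=> e; have : v 0 i < 0 by rewrite -sgr_lt0 e; lra.
  by rewrite ltNge v0.
rewrite (gtr0_sg u0); case: (leP 0 (v 0 i)) => // v0.
move=> e; have : 0 < v 0 i by rewrite -sgr_gt0 e; lra.
by rewrite ltNge (ltW v0).
Qed.

Lemma nonzeros_Proj u v :
  sgnv (Proj v u) != sgnv u -> nonzeros (Proj v u) \proper nonzeros u.
Proof.
move=> /eqP h.
have [i hi] : exists i, Num.sg (Proj v u 0 i) != Num.sg (u 0 i).
  apply/existsP; apply: contrapT => /negP; rewrite negb_exists => /forallP hh.
  by apply: h; apply/sgnvP => i; have := hh i; rewrite negbK => /eqP.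
apply/fintype.properP; split.
  apply/fintype.subsetP => j; rewrite !inE mxE.
  by apply: contraNneq => ->; rewrite ltxx.
exists i; rewrite !inE; first by apply: contraNneq hi => u0; rewrite mxE u0 ltxx.
rewrite negbK; move: hi; rewrite mxE.
have [u0|u0|u0] := ltgtP (u 0 i) 0 => //.
- case: (leP 0 (v 0 i)) => // v0.
  by rewrite !ltr0_sg// eqxx.
- case: (leP 0 (v 0 i)) => // v0.
  move: v0; rewrite le_eqVlt => /orP[/eqP <-//|v0].
  by rewrite !gtr0_sg// eqxx.
Qed.

(** The breakpoint is the smallest ratio at which a coordinate reaches zero. *)
Lemma alphaB_breakpoint u v T : dir_in_nonzeros u v -> 0 <= T ->
    sgnv (u + T *: v) != sgnv u ->
  [/\ 0 < alphaB u v, alphaB u v <= T,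
      sign_for (sgnv u) (u + alphaB u v *: v)
    & nonzeros (u + alphaB u v *: v) \proper nonzeros u].
Proof.
move=> uv T0 /eqP hT.
pose J := [pred i | u 0 i * v 0 i < 0].
pose r i := `|u 0 i| / `|v 0 i|.
have sameE a : 0 <= a -> sgnv (u + a *: v) = sgnv u <-> forall i, J i -> a < r i.
  move=> a0; split=> [/sgnvP h i Ji|h].
    by have := h i; rewrite !mxE => /eqP; have [-> _ _] := sgr_line_opp a Ji.
  apply/sgnvP => i; rewrite !mxE.
  have [u0|u0] := eqVneq (u 0 i) 0; first by rewrite uv// mulr0 u0 addr0.
  have [neg|pos] := ltP (u 0 i * v 0 i) 0; last by rewrite sgr_line_same.
  by apply/eqP; have [-> _ _] := sgr_line_opp a neg; exact: h.
have [i1 /andP[Ji1 ri1]] : exists i, J i && (r i <= T).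
  apply/existsP; apply: contrapT => /negP; rewrite negb_exists => /forallP h.
  apply: hT; apply/sameE => // i Ji; have := h i; rewrite Ji/= -ltNge; exact.
have [i0 Ji0 rmin] := @arg_minP _ _ _ i1 J r Ji1.
have r0 : 0 < r i0.
  rewrite divr_gt0 ?normr_gt0//; apply: contraTneq Ji0 => e;
    by rewrite /= e ?mulr0 ?mul0r ltxx.
have SE : [set a : R | 0 < a /\ sgnv (u + a *: v) = sgnv u] = `]0, r i0[%classic.
  apply/seteqP; split => a /=; rewrite in_itv/=.
    by move=> [a0 /(sameE _ (ltW a0)) h]; rewrite a0 h.
  move=> /andP[a0 ar]; split=> //; apply/(sameE _ (ltW a0)) => i /rmin.
  exact: lt_le_trans.
have -> : alphaB u v = r i0 by rewrite /alphaB SE sup_itv//= ?bnd_simp.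
have sg : sign_for (sgnv u) (u + r i0 *: v).
  move=> i; rewrite !mxE; split; first by rewrite normr_sg; case: (_ != _).
  have [u0|u0] := eqVneq (u 0 i) 0; first by rewrite uv// u0 mulr0 addr0 mulr0 normr0.
  have [neg|pos] := ltP (u 0 i * v 0 i) 0.
    by have [_ -> //] := sgr_line_opp (r i0) neg; apply: rmin.
  by rewrite -(sgr_line_same (ltW r0) u0 pos) normrEsg.
split=> //; first exact: le_trans (rmin _ Ji1) ri1.
apply/fintype.properP; split.
  apply/fintype.subsetP => i; rewrite !inE !mxE; apply: contraNneq => u0.
  by rewrite u0 uv// mulr0 addr0.
exists i0; rewrite !inE; first by apply: contraTneq Ji0 => e; rewrite /= e mul0r ltxx.
by rewrite negbK !mxE; have [_ _ ->] := sgr_line_opp 0 Ji0.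
Qed.

End Signs.

Section Backtracking.
Context {R : realType} {n : nat}.
Variables (f : 'rV[R]_n -> R) (lambda xi : R).
Hypothesis xi01 : 0 < xi < 1.
Variables (x d : 'rV[R]_n) (slope : R).
Hypothesis slope_le0 : slope <= 0.
Local Notation F := (objective f lambda).
Local Notation armijo t := (F (x + t *: d) <= F x + t * slope).

(** A step rejected just before the accepted one is longer than [c], so the
    accepted one is longer than [xi * c]. *)
Lemma backtrack_decrease j c b z :
  (forall m, (j <= m)%N -> xi ^+ m <= c -> armijo (xi ^+ m)) ->
  b <= xi ^+ j -> b <= xi * c ->
  backtrack f lambda xi x d slope j z -> F z <= F x + b * slope.
Proof.
have /andP[xi0 xi1] := xi01.
move=> acc bj bc bt; elim: bt acc bj => {j z} j z.
  move=> h -> _ bj; apply: le_trans h _; rewrite lerD2l.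
  exact: ler_wnM2r.
move=> rej _ IH acc bj; apply: IH.
  by move=> m jm; apply: acc; exact: ltnW.
rewrite exprS; apply: le_trans bc _; rewrite ler_pM2l// leNgt.
by apply: contra rej => /ltW; exact: acc.
Qed.

(** Going down from an acceptable exponent [m], each exponent either returns or
    hands over to the next one. *)
Lemma backtrack_returns j m : (j <= m)%N -> armijo (xi ^+ m) ->
  exists z, backtrack f lambda xi x d slope j z.
Proof.
move=> jm hm; rewrite -(subKn jm); elim: (m - j)%N => [|k [z hz]].
  by rewrite subn0; exists (x + xi ^+ m *: d); exact: BacktrackAccept.
have [h|h] := boolP (armijo (xi ^+ (m - k.+1))).
  by exists (x + xi ^+ (m - k.+1) *: d); exact: BacktrackAccept.
have [km|mk] := ltnP k m; last first.
  by exists z; move: hz; rewrite (eqP (mk : _ == _)) (eqP (leqW mk : _ == _)).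
by exists z; apply: BacktrackNext => //; rewrite -subSn.
Qed.

Lemma xi_small e : 0 < e -> exists j, forall m, (j <= m)%N -> 0 < xi ^+ m < e.
Proof.
move=> e0; have /andP[xi0 xi1] := xi01.
have : xi ^+ m @[m --> \oo] --> (0 : R).
  by apply: cvg_expr; rewrite gtr0_norm.
move=> /cvgr_lt /(_ e e0) [j _ hj]; exists j => m jm.
by rewrite exprn_gt0//=; exact: hj.
Qed.

End Backtracking.

(** * Decrease in one iteration *)

Section Steps.
Context {R : realType} {n : nat}.
Variables (f : 'rV[R]_n -> R) (lambda : R) (x0 : 'rV[R]_n).
Variables (L theta_min theta_max xi eta : R).
Hypothesis fconvex : convex_function [set: 'rV[R]_n] f.
Hypothesis fdiff : forall x, differentiable f x.
Hypothesis lambda_gt0 : 0 < lambda.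
Hypothesis L_gt0 : 0 < L.
Hypothesis theta_min_gt0 : 0 < theta_min.
Hypothesis theta_max_gt0 : 0 < theta_max.
Hypothesis xi01 : 0 < xi < 1.
Hypothesis eta01 : 0 < eta < 1.
Local Notation level := (level_set f lambda x0).
Local Notation F := (objective f lambda).
Hypothesis glip : forall x y, level x -> level y ->
  dot (grad f x - grad f y) (grad f x - grad f y)
    <= L ^+ 2 * dot (x - y) (x - y).
Hypothesis hess_bounds : forall x v, level x ->
  theta_min * dot v v <= quad (hess f x) v <= theta_max * dot v v.

(** Once the residual vanishes, only the first term of the gap bound remains,
    and it can be made arbitrarily small. *)
Lemma minimizer_of_residual0 x :
  phi f lambda x = 0 -> beta f lambda x = 0 -> minimizer F x.
Proof.
move=> p0 b0 z; rewrite leNgt; apply/negP => zx.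
pose C := \sum_i (`|x 0 i - z 0 i| + `|z 0 i| + (`|grad f x 0 i| + lambda)).
have hC i : [/\ `|x 0 i - z 0 i| <= C, `|z 0 i| <= C
               & `|grad f x 0 i| + lambda <= C].
  have : `|x 0 i - z 0 i| + `|z 0 i| + (`|grad f x 0 i| + lambda) <= C.
    rewrite /C (bigD1 i)//= lerDl sumr_ge0// => j _.
    by rewrite !addr_ge0// ltW.
  have := normr_ge0 (x 0 i - z 0 i); have := normr_ge0 (z 0 i).
  have := normr_ge0 (grad f x 0 i).
  have l0 := lambda_gt0; clearbody C.
  by move=> h1 h2 h3 h4; split; lra.
pose a := (F x - F z) / n.+1%:R.
have a0 : 0 < a by rewrite divr_gt0// subr_gt0.
have := objective_gap_le fconvex fdiff lambda_gt0 a0 hC.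
rewrite p0 b0 dot0r addr0 mulr0 addr0.
rewrite leNgt => /negP; apply.
have -> : F x - F z = n.+1%:R * a by rewrite /a mulrC divfK.
by rewrite ltr_pM2r// ltr_nat.
Qed.

Lemma backtrack_constants c : 0 < c ->
  let b := xi * Num.min 1 c in [/\ 0 < b, b <= 1 & b <= xi * c].
Proof.
have /andP[xi0 xi1] := xi01.
move=> c0 b; have m0 : 0 < Num.min 1 c by rewrite lt_min ltr01.
split; first by rewrite mulr_gt0.
  apply: mulr_ile1; rewrite ?(ltW xi0) ?(ltW m0) ?(ltW xi1)//.
  by rewrite ge_min lexx.
by rewrite ler_pM2l// ge_min lexx orbT.
Qed.

Section PhiStep.
Variables (eta_phi : R) (x : 'rV[R]_n) (I : {set 'I_n}).
Variables (dbar : 'rV[R]_#|I|) (d : 'rV[R]_n).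
Hypothesis eta_phi_gt0 : 0 < eta_phi.
Hypothesis lx : level x.
Hypothesis dir : phi_direction f lambda eta_phi x dbar d.
Local Notation pg := (grad f x + lambda *: sgnv x).
Local Notation g := (zero_outside I pg).
Local Notation slope := (dot (reduced_grad f lambda x I) dbar).

Lemma phi_dir_in_nonzeros : dir_in_nonzeros x d.
Proof.
move=> i xi0; apply: (phi_dir_out dir); apply/negP => /(phi_dir_support dir).
by rewrite phiE /phi_coord xi0 !eqxx.
Qed.

Lemma phi_slopeE : slope = dot pg d.
Proof.
by rewrite -(phi_dir_in dir) dot_subvec//; exact: (phi_dir_out dir).
Qed.

Lemma phi_slope_mask : slope = dot g d.
Proof.
rewrite phi_slopeE; apply: eq_bigr => i _; rewrite [in RHS]mxE.
by case: ifPn => // /(phi_dir_out dir) ->; rewrite !mulr0.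
Qed.

(** The reference direction minimizes the model along the reduced gradient [g],
    and its slope is [- |g|^4 / g^T H g]. *)
Lemma phi_slope_le : slope <= - (dot g g / theta_max).
Proof.
apply: le_trans (phi_dir_descent dir) _.
rewrite /reference_dir /reduced_grad /reduced_hess -subvec_zero_outside.
rewrite -subvecZ -subvecN dot_subvec; last first.
  by move=> i; rewrite !mxE => /negbTE ->; rewrite mulr0 oppr0.
rewrite (quad_submat _ (@zero_outside_out _ _ I pg)) sqr_norm2.
rewrite dot_subvec; last exact: zero_outside_out.
rewrite dotNr dotZr lerN2.
have := hess_bounds g lx; move: (quad _ _) (dot_ge0 g) => q.
rewrite le_eqVlt => /orP[/eqP <-|gg0] /andP[q1 q2].
  by rewrite !mul0r.
have q0 : 0 < q by apply: lt_le_trans q1; rewrite mulr_gt0.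
rewrite -mulrA ler_pM2l// [leRHS]mulrC ler_pdivlMr// mulrC ler_pdivrMr//.
by rewrite mulrC.
Qed.

(** The model does not increase, so half the curvature term is at most
    [- g^T d]; Young's inequality absorbs [d] on the right-hand side. *)
Lemma phi_dir_bound : dot d d <= 4 / theta_min ^+ 2 * dot g g.
Proof.
have := phi_dir_model dir; rewrite /model.
rewrite [quad _ 0]dot0r dot0r mulr0 addr0 phi_slope_mask.
rewrite -(phi_dir_in dir) /reduced_hess quad_submat; last exact: phi_dir_out dir.
have /andP[hq _] := hess_bounds d lx.
have a0 : 0 < 2 / theta_min by rewrite divr_gt0.
have := young_dot (- g) d a0; rewrite dotNl !dotNr dotNl opprK => hy hm.
have h : theta_min / 2 * dot d d <= - dot g d by move: hq hm; lra.
have := le_trans h hy; have t0 := theta_min_gt0.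
have -> : 2 / theta_min / 2 = theta_min^-1 by field; apply/lt0r_neq0.
have -> : (2 / theta_min * 2)^-1 = theta_min / 4 by field; apply/lt0r_neq0.
move=> h2; have h3 : theta_min / 4 * dot d d <= theta_min^-1 * dot g g by lra.
rewrite -(ler_pM2l (_ : 0 < theta_min / 4)) ?divr_gt0//.
apply: le_trans h3 _.
have -> // : theta_min / 4 * (4 / theta_min ^+ 2 * dot g g) = theta_min^-1 * dot g g.
by field; apply/lt0r_neq0.
Qed.

Lemma phi_reduced_grad_ge :
  eta_phi ^+ 2 * dot (phi f lambda x) (phi f lambda x) <= dot g g.
Proof.
have := phi_dir_large dir; rewrite ler_norm2 ?(ltW eta_phi_gt0)// => /le_trans; apply.
rewrite -subvec_zero_outside dot_subvec; last exact: zero_outside_out.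
apply: ler_sum => i _; rewrite -!expr2 ![zero_outside _ _ _ _]mxE.
case: ifPn => // /(phi_dir_support dir) pi0.
rewrite -[leLHS]real_normK ?num_real// -[leRHS]real_normK ?num_real//.
rewrite ler_pXn2r ?nnegrE//.
have xi0 : x 0 i != 0.
  by apply: contraNneq pi0 => xi0; rewrite phiE /phi_coord xi0 eqxx.
have -> : pg 0 i = grad f x 0 i + lambda * Num.sg (x 0 i) by rewrite !mxE.
by rewrite phiE; exact: phi_coord_le.
Qed.

Lemma phi_slope_le_phi :
  slope <= - (eta_phi ^+ 2 / theta_max * dot (phi f lambda x) (phi f lambda x)).
Proof.
apply: le_trans phi_slope_le _.
rewrite lerN2 mulrAC ler_pM2r ?invr_gt0//; exact: phi_reduced_grad_ge.
Qed.

(** [(1 - eta) * - slope / (L * |d|^2)] is at least this number, by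
    [phi_slope_le] and [phi_dir_bound]. *)
Definition phi_step_bound := (1 - eta) * theta_min ^+ 2 / (4 * L * theta_max).

Lemma phi_step_bound_gt0 : 0 < phi_step_bound.
Proof.
have /andP[_ eta1] := eta01.
by rewrite divr_gt0 ?mulr_gt0 ?exprn_gt0// subr_gt0.
Qed.

Lemma phi_armijo t : 0 < t -> t <= phi_step_bound -> slope < 0 ->
  sign_for (sgnv x) (x + t *: d) -> F (x + t *: d) <= F x + t * (eta * slope).
Proof.
move=> t0 tc sl0 sxt.
have -> : t * (eta * slope) = eta * t * dot pg d by rewrite -phi_slopeE; ring.
have sx : sign_for (sgnv x) x by exact: sign_for_sgnv.
apply: (armijo_short_step fconvex fdiff L_gt0 glip eta01 lx t0 sx sxt).
  by rewrite -phi_slopeE.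
rewrite -phi_slopeE.
have /andP[_ eta1] := eta01.
have gg : dot g g / theta_max <= - slope by have := phi_slope_le; lra.
apply: (@le_trans _ _ ((1 - eta) * (dot g g / theta_max))); last first.
  by rewrite ler_pM2l// subr_gt0.
apply: (@le_trans _ _ (L * (4 / theta_min ^+ 2 * dot g g) * phi_step_bound)).
  apply: ler_pM => //; rewrite ?mulr_ge0 ?dot_ge0 ?(ltW L_gt0) ?(ltW t0)//.
  by rewrite ler_pM2l//; exact: phi_dir_bound.
rewrite /phi_step_bound le_eqVlt; apply/orP; left; apply/eqP.
by field; rewrite !lt0r_neq0.
Qed.

Hypothesis slope_lt0 : slope < 0.

Lemma phi_backtrack_accepts j m : sgnv (x + xi ^+ j *: d) = sgnv x -> (j <= m)%N ->
  xi ^+ m <= phi_step_bound ->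
  F (x + xi ^+ m *: d) <= F x + xi ^+ m * (eta * slope).
Proof.
have /andP[xi0 xi1] := xi01.
move=> sj jm mc; apply: phi_armijo => //; first exact: exprn_gt0.
apply: sign_for_sgnv; apply: (sgnv_shorter phi_dir_in_nonzeros) sj.
by rewrite exprn_ge0 ?(ltW xi0)//= ler_wiXn2l// ltW.
Qed.

Lemma trial_sgnv j :
  (sgnv (trial xi x d j) == sgnv x) = (sgnv (x + xi ^+ j *: d) == sgnv x).
Proof.
apply: sgnv_Proj => i xi0; by rewrite !mxE xi0 (phi_dir_in_nonzeros xi0) mulr0 addr0.
Qed.

(** Small steps keep the signs, so the while-loop reaches an exponent [m] at
    which it stops; the run is rebuilt from [m] down to zero. *)
Lemma linesearch_phi_returns : exists z, linesearch_phi f lambda xi eta x d slope z.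
Proof.
have [e e0 he] := sgnv_small_step phi_dir_in_nonzeros.
have [m hm] := xi_small xi01 (e0 : 0 < e).
have /andP[xm0 xme] := hm m (leqnn m).
have sm : sgnv (x + xi ^+ m *: d) = sgnv x by apply: he; rewrite (ltW xm0).
have bt j : sgnv (x + xi ^+ j *: d) = sgnv x ->
    exists z, backtrack f lambda xi x d (eta * slope) j z.
  move=> sj; have [k hk] := xi_small xi01 phi_step_bound_gt0.
  apply: (@backtrack_returns _ _ _ _ _ _ _ _ _ (maxn j k)); first exact: leq_maxl.
  apply: phi_backtrack_accepts sj _ _; first exact: leq_maxl.
  by apply: ltW; have /andP[] := hk (maxn j k) (leq_maxr _ _).
have same j : sgnv (x + xi ^+ j *: d) = sgnv x ->
    exists z, linesearch_phi_from f lambda xi eta x d slope j z.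
  move=> sj; have [z hz] := bt j sj.
  have [/andP[j0 ab]|] := boolP ((j != 0%N) && alphaB_accepted f lambda eta x d slope).
    exists (x + alphaB x d *: d).
    by apply: LphiAlphaB => //; rewrite trial_sgnv sj.
  rewrite negb_and negbK => h; exists z.
  by apply: LphiBacktrack => //; rewrite trial_sgnv sj.
suff H k : exists z, linesearch_phi_from f lambda xi eta x d slope (m - k) z.
  by have := H m; rewrite subnn.
elim: k => [|k [z hz]]; first by rewrite subn0; exact: same.
have [km|mk] := ltnP k m; last first.
  by exists z; move: hz; rewrite (eqP (mk : _ == _)) (eqP (leqW mk : _ == _)).
have [/eqP sj|sj] := boolP (sgnv (trial xi x d (m - k.+1)) == sgnv x).
  by apply: same; apply/eqP; rewrite -trial_sgnv sj.
have [Fj|Fj] := boolP (F (trial xi x d (m - k.+1)) <= F x).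
  by exists (trial xi x d (m - k.+1)); exact: LphiReturn.
by exists z; apply: LphiNext => //; rewrite -subSn.
Qed.

(** The loop invariant is that the previous trial step changed a sign; it
    places the breakpoint [alphaB] below the previous step length. *)
Lemma linesearch_phi_step z : linesearch_phi f lambda xi eta x d slope z ->
  F z <= F x /\ (nonzeros z \proper nonzeros x \/
                 F z <= F x + xi * Num.min 1 phi_step_bound * (eta * slope)).
Proof.
have /andP[xi0 xi1] := xi01; have /andP[eta0 eta1] := eta01.
have es0 : eta * slope <= 0 by rewrite pmulr_rle0// ltW.
have [b0 b1 bc] := backtrack_constants phi_step_bound_gt0.
have step j : j = 0%N \/ sgnv (trial xi x d j.-1) != sgnv x ->
    linesearch_phi_from f lambda xi eta x d slope j z ->
    F z <= F x /\ (nonzeros z \proper nonzeros x \/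
                   F z <= F x + xi * Num.min 1 phi_step_bound * (eta * slope)).
  move=> inv ls; elim: ls inv => {}j {}z.
  - by move=> sj Fj -> _; split=> //; left; exact: (nonzeros_Proj sj).
  - by move=> sj _ _ IH _; apply: IH; right.
  - move=> sj j0 acc -> [j0'|sj1]; first by rewrite j0' in j0.
    rewrite trial_sgnv in sj1.
    have [a0 aT sa prop] := alphaB_breakpoint phi_dir_in_nonzeros
      (exprn_ge0 j.-1 (ltW xi0)) sj1.
    split; last by left.
    by apply: le_trans acc _; rewrite gerDl -mulrA mulrCA pmulr_rle0.
  - rewrite trial_sgnv => /eqP sj acc bt inv.
    have Fz : F z <= F x + xi * Num.min 1 phi_step_bound * (eta * slope).
      apply: (backtrack_decrease xi01 es0 _ _ bc bt).
        by move=> m jm; exact: phi_backtrack_accepts sj jm.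
      case: inv acc => [->|sj1]; first by rewrite expr0.
      have [->|j0 /= acc] := eqVneq j 0%N; first by rewrite expr0.
      rewrite trial_sgnv in sj1.
      have [a0 aT sa prop] := alphaB_breakpoint phi_dir_in_nonzeros
        (exprn_ge0 j.-1 (ltW xi0)) sj1.
      (* A rejected breakpoint violates the Armijo condition, hence is far. *)
      have ca : phi_step_bound < alphaB x d.
        rewrite ltNge; apply: contra acc => ac.
        by rewrite /alphaB_accepted -mulrA mulrCA; exact: phi_armijo.
      apply: le_trans bc _; rewrite -(prednK (_ : 0 < j)%N) ?lt0n// exprS.
      by rewrite ler_pM2l//; apply: le_trans aT; exact: ltW.
    split; last by right.
    by apply: le_trans Fz _; rewrite gerDl pmulr_rle0.
by move=> ls; apply: (step 0%N) ls; left.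
Qed.

Lemma phi_iterate_step z : linesearch_phi f lambda xi eta x d slope z ->
  F z <= F x /\ (nonzeros z \proper nonzeros x \/
    xi * Num.min 1 phi_step_bound * eta * eta_phi ^+ 2 / theta_max
      * dot (phi f lambda x) (phi f lambda x) <= F x - F z).
Proof.
have /andP[xi0 xi1] := xi01; have /andP[eta0 eta1] := eta01.
have [b0 b1 bc] := backtrack_constants phi_step_bound_gt0.
move=> /linesearch_phi_step[Fz [prop|dec]]; split=> //; [by left|right].
have := phi_slope_le_phi; move: dec b0; set b := xi * _ => dec b0.
set pp := dot (phi f lambda x) _.
have be0 : 0 < b * eta by rewrite mulr_gt0.
rewrite -(ler_pM2l be0) mulrN => h; rewrite mulrA in dec.
have -> : b * eta * eta_phi ^+ 2 / theta_max * pp =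
  b * eta * (eta_phi ^+ 2 / theta_max * pp) by rewrite !mulrA.
lra.
Qed.

End PhiStep.

Section BetaStep.
Variables (eta_beta : R) (x : 'rV[R]_n) (I : {set 'I_n}) (d : 'rV[R]_n).
Hypothesis eta_beta_gt0 : 0 < eta_beta.
Hypothesis lx : level x.
Hypothesis dir : beta_direction f lambda eta_beta x I d.
Local Notation s := (sgnv x + sgnv d).

Lemma beta_dirE : d = - zero_outside I (beta f lambda x).
Proof.
apply/rowP => i; rewrite [RHS]mxE [zero_outside _ _ _ _]mxE.
case: ifPn => [iI|/(beta_dir_out dir) ->]; last by rewrite oppr0.
have := congr1 (fun w : 'rV[R]_#|I| => w 0 (enum_rank_in iI i)) (beta_dir_in dir).
by rewrite [LHS]mxE [RHS]mxE [X in - X]mxE enum_rankK_in.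
Qed.

(** Moving off zero, the l1-norm has slope [sgn d], and [d] is minus the
    resulting partial derivative of the objective. *)
Lemma beta_dir_coord i : d 0 i = 0 \/
  (x 0 i = 0 /\ grad f x 0 i + lambda * Num.sg (d 0 i) = - d 0 i).
Proof.
have l0 := lambda_gt0; have := congr1 (fun w : 'rV[R]_n => w 0 i) beta_dirE.
rewrite [X in _ = X -> _]mxE [X in _ = - X -> _]mxE.
case: ifPn => [_|_ ->]; last by left; rewrite oppr0.
rewrite betaE /beta_coord; case: eqP => [xi0|_ ->]; last by left; rewrite oppr0.
case: ifPn => [g1 ->|_].
  by right; split=> //; rewrite gtr0_sg ?oppr_gt0// mulr1 opprK.
case: ifPn => [g2 ->|_ ->]; last by left; rewrite oppr0.
by right; split=> //; rewrite ltr0_sg ?oppr_lt0// mulrN1 opprK.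
Qed.

Lemma beta_slopeE : dot (grad f x + lambda *: s) d = - dot d d.
Proof.
rewrite /dot -sumrN; apply: eq_bigr => i _.
rewrite [X in X * _]mxE [X in _ + X]mxE [X in _ + _ * X]mxE.
rewrite [sgnv x 0 i]mxE [sgnv d 0 i]mxE.
have [->|[-> e]] := beta_dir_coord i; first by rewrite !mulr0 oppr0.
by rewrite sgr0 add0r e mulNr.
Qed.

Lemma beta_sign_for t : 0 <= t -> sign_for s (x + t *: d).
Proof.
move=> t0 i; rewrite !mxE.
have [->|[-> _]] := beta_dir_coord i.
  rewrite mulr0 sgr0 !addr0 normr_sg -normrEsg; split=> //.
  by case: (_ != _).
rewrite sgr0 !add0r normr_sg normrM ger0_norm// normrEsg; split; last by ring.
by case: (_ != _).
Qed.

Definition beta_step_bound := (1 - eta) / L.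

Lemma beta_step_bound_gt0 : 0 < beta_step_bound.
Proof. by have /andP[_ eta1] := eta01; rewrite divr_gt0// subr_gt0. Qed.

Lemma beta_dir_ge :
  eta_beta ^+ 2 * dot (beta f lambda x) (beta f lambda x) <= dot d d.
Proof.
have := beta_dir_large dir; rewrite ler_norm2 ?(ltW eta_beta_gt0)//.
move=> /le_trans; apply; rewrite beta_dirE dotNl dotNr opprK.
by rewrite -subvec_zero_outside dot_subvec//; exact: zero_outside_out.
Qed.

Hypothesis d_neq0 : 0 < dot d d.

Lemma beta_armijo t : 0 < t -> t <= beta_step_bound ->
  F (x + t *: d) <= F x + t * - (eta * norm2 d ^+ 2).
Proof.
move=> t0; rewrite ler_pdivlMr// => tc.
have -> : t * - (eta * norm2 d ^+ 2) = eta * t * dot (grad f x + lambda *: s) d.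
  by rewrite beta_slopeE sqr_norm2; ring.
have sx : sign_for s x by have := beta_sign_for (lexx 0); rewrite scale0r addr0.
apply: (armijo_short_step fconvex fdiff L_gt0 glip eta01 lx t0 sx).
- by apply: beta_sign_for; exact: ltW.
- by rewrite beta_slopeE oppr_lt0.
by rewrite beta_slopeE opprK mulrAC ler_pM2r// mulrC.
Qed.

Lemma linesearch_beta_returns : exists z, linesearch_beta f lambda xi eta x d z.
Proof.
have [k hk] := xi_small xi01 beta_step_bound_gt0.
have /andP[k0 kc] := hk k (leqnn k).
apply: (@backtrack_returns _ _ _ _ _ _ _ _ _ k) => //.
by apply: beta_armijo => //; exact: ltW.
Qed.

Lemma beta_iterate_step z : linesearch_beta f lambda xi eta x d z ->
  xi * Num.min 1 beta_step_bound * eta * eta_beta ^+ 2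
      * dot (beta f lambda x) (beta f lambda x) <= F x - F z.
Proof.
have /andP[xi0 xi1] := xi01; have /andP[eta0 eta1] := eta01.
have [b0 b1 bc] := backtrack_constants beta_step_bound_gt0.
have sl : - (eta * norm2 d ^+ 2) <= 0.
  by rewrite oppr_le0 sqr_norm2 mulr_ge0 ?dot_ge0// ltW.
move=> bt; have acc m : (0 <= m)%N -> xi ^+ m <= beta_step_bound ->
    F (x + xi ^+ m *: d) <= F x + xi ^+ m * - (eta * norm2 d ^+ 2).
  by move=> _ mc; apply: beta_armijo => //; exact: exprn_gt0.
have b1' : xi * Num.min 1 beta_step_bound <= xi ^+ 0 by rewrite expr0.
have := backtrack_decrease xi01 sl acc b1' bc bt.
rewrite sqr_norm2; move: b0; set b := xi * _ => b0 h.
have be0 : 0 < b * eta by rewrite mulr_gt0.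
have := beta_dir_ge; rewrite -(ler_pM2l be0) => h2; rewrite -[leLHS]mulrA.
by apply: le_trans h2 _; move: h; rewrite mulrN mulrA; lra.
Qed.

End BetaStep.

Section Iteration.
Variables (eta_phi eta_beta gamma : R).
Hypothesis eta_phi01 : 0 < eta_phi <= 1.
Hypothesis eta_beta01 : 0 < eta_beta <= 1.
Hypothesis gamma_gt0 : 0 < gamma.

Definition residual x :=
  dot (phi f lambda x) (phi f lambda x) + dot (beta f lambda x) (beta f lambda x).

(** The full set of nonzeros of [phi] with the reference direction itself. *)
Lemma phi_direction_exists x : level x ->
  exists (I : {set 'I_n}) (dbar : 'rV[R]_#|I|) d, phi_direction f lambda eta_phi x dbar d.
Proof.
move=> lx; have /andP[ep0 ep1] := eta_phi01.
pose I := [set i | phi f lambda x 0 i != 0]%SET.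
pose pg := grad f x + lambda *: sgnv x.
pose g := zero_outside I pg.
have gI i : i \notin I -> g 0 i = 0 by exact: zero_outside_out.
pose c := norm2 (reduced_grad f lambda x I) ^+ 2 /
  quad (reduced_hess f x I) (reduced_grad f lambda x I).
pose d := - (c *: g).
have dI i : i \notin I -> d 0 i = 0.
  by move=> iI; rewrite !mxE (negbTE iI) mulr0 oppr0.
have dE : subvec I d = reference_dir f lambda x I.
  by rewrite subvecN subvecZ subvec_zero_outside.
exists I, (reference_dir f lambda x I), d; split=> //.
- by move=> i; rewrite inE.
- rewrite ler_norm2 ?(ltW ep0)//.
  rewrite -subvec_zero_outside dot_subvec; last exact: zero_outside_out.
  have -> : zero_outside I (phi f lambda x) = phi f lambda x.
    by apply/rowP => i; rewrite [LHS]mxE inE; case: eqP.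
  by rewrite ler_piMl ?dot_ge0// exprn_ile1// ltW.
rewrite /model [quad _ 0]dot0r dot0r mulr0 addr0.
rewrite -dE /reduced_hess quad_submat// {1}/reduced_grad dot_subvec//.
have -> : dot (grad f x + lambda *: sgnv x) d = - (c * dot g g).
  rewrite dotNr dotZr; congr (- (_ * _)); apply: eq_bigr => i _.
  have [iI|iI] := boolP (i \in I); last by rewrite (gI _ iI) !mulr0.
  by rewrite [zero_outside _ _ _ _]mxE iI.
have cE : c = dot g g / quad (hess f x) g.
  rewrite /c sqr_norm2 /reduced_grad -/pg -subvec_zero_outside -/g.
  by rewrite dot_subvec// /reduced_hess quad_submat.
rewrite /d -(scaleNr c g) quadZ sqrrN.
have := hess_bounds g lx; rewrite cE; move: (quad _ _) => q /andP[q1 _].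
have := dot_ge0 g; rewrite le_eqVlt => /orP[/eqP <-|gg0].
  by rewrite !mul0r oppr0 expr0n /= !mul0r mulr0 addr0.
have q0 : 0 < q by apply: lt_le_trans q1; rewrite mulr_gt0.
have -> : - (dot g g / q * dot g g) + 2^-1 * ((dot g g / q) ^+ 2 * q) =
  - (dot g g ^+ 2 / q / 2) by field; apply/lt0r_neq0.
by rewrite oppr_le0 !mulr_ge0 ?invr_ge0 ?(ltW q0) ?(ltW gg0).
Qed.

Lemma beta_direction_exists x :
  exists (I : {set 'I_n}) d, beta_direction f lambda eta_beta x I d.
Proof.
have /andP[ep0 ep1] := eta_beta01.
pose I := [set i | beta f lambda x 0 i != 0]%SET.
exists I, (- beta f lambda x); split.
- by move=> i; rewrite inE.
- rewrite ler_norm2 ?(ltW ep0)//.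
  rewrite -subvec_zero_outside dot_subvec; last exact: zero_outside_out.
  have -> : zero_outside I (beta f lambda x) = beta f lambda x.
    by apply/rowP => i; rewrite [LHS]mxE inE; case: eqP.
  by rewrite ler_piMl ?dot_ge0// exprn_ile1// ltW.
- by rewrite subvecN.
by move=> i; rewrite inE negbK [X in _ -> X = _]mxE => /eqP ->; rewrite oppr0.
Qed.

Lemma terminate_minimizer x : terminate f lambda 0 x -> minimizer F x.
Proof.
rewrite /terminate ge_max => /andP[b0 p0].
have Z (v : 'rV[R]_n) : norm2 v <= 0 -> v = 0.
  move=> v0; apply: dot_le0_eq0; rewrite -sqr_norm2.
  have -> : norm2 v = 0 by apply: le_anti; rewrite v0 norm2_ge0.
  by rewrite expr0n.
by apply: minimizer_of_residual0; apply: Z.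
Qed.

(** In each branch the branch condition bounds the other residual, so the
    decrease in terms of [phi] or [beta] becomes one in terms of both. *)
Lemma iteration_step : exists2 kappa : R, 0 < kappa & forall x o,
  level x -> ~ minimizer F x ->
  iteration f lambda eta_phi eta_beta xi eta gamma 0 x o ->
  exists z, [/\ o = Some z, F z <= F x &
    nonzeros z \proper nonzeros x \/ kappa * residual x <= F x - F z].
Proof.
have /andP[xi0 xi1] := xi01; have /andP[eta0 eta1] := eta01.
have /andP[ep0 ep1] := eta_phi01; have /andP[eb0 eb1] := eta_beta01.
pose kp := xi * Num.min 1 phi_step_bound * eta * eta_phi ^+ 2 / theta_max.
pose kb := xi * Num.min 1 beta_step_bound * eta * eta_beta ^+ 2.
have kp0 : 0 < kp.
  have [b0 _ _] := backtrack_constants phi_step_bound_gt0.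
  by rewrite divr_gt0// mulr_gt0 ?exprn_gt0// mulr_gt0.
have kb0 : 0 < kb.
  have [b0 _ _] := backtrack_constants beta_step_bound_gt0.
  by rewrite mulr_gt0 ?exprn_gt0// mulr_gt0.
have g2 : 0 < 1 + gamma ^+ 2 by rewrite ltr_pwDl// exprn_ge0// ltW.
have gm2 : 0 < 1 + (gamma ^+ 2)^-1.
  by rewrite ltr_pwDl// invr_ge0 exprn_ge0// ltW.
pose kappa := Num.min (kp / (1 + gamma ^+ 2)) (kb / (1 + (gamma ^+ 2)^-1)).
have kpE : kp = xi * Num.min 1 phi_step_bound * eta * eta_phi ^+ 2 / theta_max by [].
have kbE : kb = xi * Num.min 1 beta_step_bound * eta * eta_beta ^+ 2 by [].
clearbody kp kb; have kappa0 : 0 < kappa by rewrite lt_min; apply/andP; split; exact: divr_gt0.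
exists kappa => //.
move=> x o lx xmin it.
have res0 : 0 <= residual x by apply: addr_ge0; exact: dot_ge0.
have ep_pos : 0 < eta_phi ^+ 2 / theta_max by rewrite divr_gt0// exprn_gt0.
set pp := dot (phi f lambda x) (phi f lambda x).
set bb := dot (beta f lambda x) (beta f lambda x).
have resE : residual x = pp + bb by [].
have pp0 : 0 <= pp := dot_ge0 _.
have bb0 : 0 <= bb := dot_ge0 _.
have phi_est : phi_branch f lambda gamma x -> 0 < pp /\ kappa * residual x <= kp * pp.
  rewrite /phi_branch => bp.
  have bg : bb <= gamma ^+ 2 * pp.
    rewrite /bb /pp -!sqr_norm2 -exprMn ler_pXn2r// nnegrE ?mulr_ge0 ?norm2_ge0//.
    exact: ltW.
  split.
    rewrite lt_neqAle pp0 andbT eq_sym; apply/eqP => p0; apply: xmin.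
    rewrite p0 mulr0 in bg.
    apply: minimizer_of_residual0; first by apply: dot_le0_eq0; rewrite -/pp p0.
    exact: dot_le0_eq0.
  apply: (@le_trans _ _ (kp / (1 + gamma ^+ 2) * residual x)).
    by rewrite ler_wpM2r// ge_min lexx.
  rewrite -mulrA ler_pM2l// mulrC ler_pdivrMr// resE; lra.
have beta_est : ~~ phi_branch f lambda gamma x ->
    0 < bb /\ kappa * residual x <= kb * bb.
  rewrite /phi_branch -ltNge => bp.
  have nb : 0 < norm2 (beta f lambda x).
    by apply: le_lt_trans bp; rewrite mulr_ge0 ?norm2_ge0// ltW.
  split; first by rewrite /bb -sqr_norm2 exprn_gt0.
  have := ltW bp; rewrite ler_norm2 ?(ltW gamma_gt0)// -/pp -/bb => gp.
  apply: (@le_trans _ _ (kb / (1 + (gamma ^+ 2)^-1) * residual x)).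
    by rewrite ler_wpM2r// ge_min lexx orbT.
  rewrite -mulrA ler_pM2l// mulrC ler_pdivrMr// resE mulrDr mulr1 addrC lerD2l.
  by rewrite ler_pdivlMr ?exprn_gt0// mulrC.
case: it.
- by move=> /terminate_minimizer.
- move=> I dbar d _ /phi_est[p0 est] dir out.
  have slope0 : dot (reduced_grad f lambda x I) dbar < 0.
    by apply: le_lt_trans (phi_slope_le_phi ep0 lx dir) _; rewrite oppr_lt0 mulr_gt0.
  case: o out => [z|] /= out; last first.
    have [z hz] := linesearch_phi_returns lx dir slope0.
    by case: (out z).
  have [Fz [prop|dec]] := phi_iterate_step ep0 lx dir slope0 out; exists z.
    by split=> //; left.
  by rewrite -kpE in dec; split=> //; right; exact: le_trans est dec.
- move=> _ _ nodir _; have [I [dbar [d dir]]] := phi_direction_exists lx.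
  by case: (nodir I dbar d).
- move=> I d _ /beta_est[b0 est] dir out.
  have d0 : 0 < dot d d.
    by apply: lt_le_trans (beta_dir_ge eb0 dir); rewrite mulr_gt0// exprn_gt0.
  case: o out => [z|] /= out; last first.
    have [z hz] := linesearch_beta_returns lx dir d0.
    by case: (out z).
  have := beta_iterate_step eb0 lx dir d0 out; rewrite -kbE => dec.
  have := le_trans est dec => kr; exists z; split=> //; last by right.
  by rewrite -subr_ge0; apply: le_trans kr; rewrite mulr_ge0// ltW.
- move=> _ _ nodir _; have [I [d dir]] := beta_direction_exists x.
  by case: (nodir I d).
Qed.

End Iteration.
End Steps.

(** * Convergence *)

Section Convergence.
Context {R : realType}.

Lemma cvg_rowP {n : nat} (u : nat -> 'rV[R]_n) (l : 'rV[R]_n) :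
  (forall i e, 0 < e -> exists K, forall k, (K <= k)%N -> `|u k 0 i - l 0 i| < e) ->
  u @ \oo --> l.
Proof.
move=> h; apply/cvgrPdist_le => /= e e0; near=> k.
rewrite /Num.Def.normr/= mx_normrE (bigmax_le _ (ltW e0))//= => -[j i] _ /=.
rewrite (ord1 j) mxE [X in _ + X]mxE distrC; apply: ltW.
move: i; near: k; apply: filter_forall => i.
by have [K hK] := h i e e0; exists K.
Unshelve. all: by end_near. Qed.

(** Steps that only shrink [A] run out after [#|A k|] of them, so the sequence
    keeps dropping by [del] and becomes negative. *)
Lemma no_persistent_descent (T : finType) (A : nat -> {set T}) (a : nat -> R) (del : R) :
  0 < del -> (forall k, 0 <= a k) -> (forall k, a k.+1 <= a k) ->
  (forall k, A k.+1 \proper A k \/ a k.+1 <= a k - del) -> False.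
Proof.
move=> del0 a0 amon step.
have drop k : exists k', a k' <= a k - del.
  have [m] := ubnP #|A k|; elim: m k => // m IH k; rewrite ltnS => Am.
  have [prop|dec] := step k; last by exists k.+1.
  have [k' hk'] := IH k.+1 (leq_trans (proper_card prop) Am).
  by exists k'; apply: le_trans hk' _; rewrite lerD2r.
have drops m : exists k, a k <= a 0%N - m%:R * del.
  elim: m => [|m [k hk]]; first by exists 0%N; rewrite mul0r subr0.
  have [k' hk'] := drop k; exists k'; apply: le_trans hk' _.
  by rewrite -natr1; lra.
pose m := Num.bound (a 0%N / del).
have [k hk] := drops m.
have : a 0%N / del < m%:R.
  by apply: le_lt_trans (archi_boundP _); rewrite ?ler_norm ?divr_ge0// ltW.
rewrite ltr_pdivrMr// => hm; have := a0 k; lra.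
Qed.

Context {n : nat}.
Variables (f : 'rV[R]_n -> R) (lambda : R) (x0 z : 'rV[R]_n).
Variables (L theta : R).
Hypothesis fconvex : convex_function [set: 'rV[R]_n] f.
Hypothesis fC2 : twice_continuously_differentiable f.
Hypothesis lambda_gt0 : 0 < lambda.
Hypothesis L_gt0 : 0 < L.
Hypothesis theta_gt0 : 0 < theta.
Local Notation level := (level_set f lambda x0).
Local Notation F := (objective f lambda).
Hypothesis glip : forall x y, level x -> level y ->
  dot (grad f x - grad f y) (grad f x - grad f y)
    <= L ^+ 2 * dot (x - y) (x - y).
Hypothesis hess_lb : forall x v, level x -> theta * dot v v <= quad (hess f x) v.
Hypothesis zmin : minimizer F z.

Let level_z : level z. Proof. exact: zmin. Qed.

Lemma dist_minimizer_le x : level x ->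
  dot (x - z) (x - z) <= 8 / theta * (F x - F z).
Proof.
move=> lx.
have := quadratic_growth fconvex fC2 lambda_gt0 (ltW theta_gt0) hess_lb zmin lx.
by rewrite mulrAC ler_pdivrMr// mulrAC ler_pdivlMr// mulrC (mulrC 8).
Qed.

(** Quadratic growth bounds the level set, and the Lipschitz condition then
    bounds the gradient on it, so one constant serves in [objective_gap_le]. *)
Lemma residual_bounded_below e : 0 < e ->
  exists2 del : R, 0 < del &
    forall x, level x -> e <= F x - F z -> del <= residual f lambda x.
Proof.
move=> e0; have [fdiff _ _] := fC2.
(* [B] bounds the squared distance to [z] on the level set. *)
pose B := 8 / theta * (F x0 - F z).
have B0 : 0 <= B by rewrite mulr_ge0 ?divr_ge0 ?subr_ge0// ltW.
pose G := \sum_i `|z 0 i| + \sum_i `|grad f z 0 i|.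
have Gz i : `|z 0 i| + `|grad f z 0 i| <= G.
  by rewrite /G lerD// (bigD1 i)//= lerDl sumr_ge0.
pose C := B + 1 + G + (L ^+ 2 * B + 1) + lambda.
have absr_le (r : R) : `|r| <= r ^+ 2 + 1.
  by rewrite ler_norml; apply/andP; split; nra.
have LB0 : 0 <= L ^+ 2 * B by rewrite mulr_ge0// exprn_ge0// ltW.
have bnd x : level x -> forall i, [/\ `|x 0 i - z 0 i| <= C, `|z 0 i| <= C
               & `|grad f x 0 i| + lambda <= C].
  move=> lx i; have l0 := lambda_gt0.
  have hB : dot (x - z) (x - z) <= B.
    apply: le_trans (dist_minimizer_le lx) _.
    by rewrite ler_pM2l ?divr_gt0// lerD2r.
  have h1 : (x 0 i - z 0 i) ^+ 2 <= B.
    by apply: le_trans hB; exact: coordB_sqr_le_dot.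
  have h2 : (grad f x 0 i - grad f z 0 i) ^+ 2 <= L ^+ 2 * B.
    apply: le_trans (coordB_sqr_le_dot _ _ _) (le_trans (glip lx level_z) _).
    by rewrite ler_pM2l// exprn_gt0.
  have := absr_le (x 0 i - z 0 i); have := absr_le (grad f x 0 i - grad f z 0 i).
  have := Gz i; have := normr_ge0 (z 0 i); have := normr_ge0 (grad f z 0 i).
  have : `|grad f x 0 i| <= `|grad f z 0 i| + `|grad f x 0 i - grad f z 0 i|.
    by rewrite -{1}(subrKC (grad f z 0 i) (grad f x 0 i)) ler_normD.
  rewrite /C; clearbody G B; move: (L ^+ 2 * B) LB0 h2 => LB LB0 h2.
  by move=> h3 h4 h5 h6 h7 h8; split; lra.
have C0 : 0 < C.
  have G0 : 0 <= G by rewrite addr_ge0// sumr_ge0.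
  have l0 := lambda_gt0; rewrite /C; clearbody G B.
  by move: (L ^+ 2 * B) LB0 => LB LB0; lra.
clearbody C.
(* With this [a], the first term of the gap bound is at most [e / 2]. *)
pose a := e / 2 / n.+1%:R.
have a0 : 0 < a by rewrite !divr_gt0.
exists (e / 2 * a / (4 * C ^+ 2)).
  by rewrite !divr_gt0 ?mulr_gt0 ?divr_gt0 ?exprn_gt0.
move=> x lx ex; rewrite ler_pdivrMr ?mulr_gt0 ?exprn_gt0//.
have := le_trans ex (objective_gap_le fconvex fdiff lambda_gt0 a0 (bnd x lx)).
rewrite -/(residual f lambda x).
have : n%:R * a <= e / 2.
  have -> : e / 2 = n.+1%:R * a by rewrite /a [RHS]mulrC divfK.
  by rewrite ler_pM2r// ler_nat.
move=> h1 h2; rewrite -ler_pdivlMr//.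
have -> : residual f lambda x * (4 * C ^+ 2) / a =
  4 * C ^+ 2 / a * residual f lambda x by ring.
lra.
Qed.

Variable x : nat -> 'rV[R]_n.
Hypothesis level_x : forall k, level (x k).
Variable kappa : R.
Hypothesis kappa_gt0 : 0 < kappa.
Hypothesis step : forall k, F (x k.+1) <= F (x k) /\
  (nonzeros (x k.+1) \proper nonzeros (x k) \/
   kappa * residual f lambda (x k) <= F (x k) - F (x k.+1)).

Lemma objective_cvg e : 0 < e ->
  exists K, forall k, (K <= k)%N -> F (x k) - F z < e.
Proof.
move=> e0.
have [[K hK]|none] := pselect (exists K, F (x K) - F z < e).
  exists K => k; elim: k => [|k IH]; first by rewrite leqn0 => /eqP <-.
  rewrite leq_eqVlt => /orP[/eqP <-//|/IH]; apply: le_lt_trans.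
  by rewrite lerD2r; have [] := step k.
exfalso; have big k : e <= F (x k) - F z.
  by rewrite leNgt; apply/negP => h; apply: none; exists k.
have [del del0 hdel] := residual_bounded_below e0.
apply: (@no_persistent_descent _ (fun k => nonzeros (x k))
  (fun k => F (x k) - F z) (kappa * del)).
- by rewrite mulr_gt0.
- by move=> k; rewrite subr_ge0; exact: zmin.
- by move=> k; rewrite lerD2r; have [] := step k.
move=> k; have [_ [|dec]] := step k; [by left|right].
have : kappa * del <= kappa * residual f lambda (x k).
  by rewrite ler_pM2l//; exact: hdel.
lra.
Qed.

Lemma iterates_close e : 0 < e -> exists K, forall k, (K <= k)%N ->
  forall i, `|x k 0 i - z 0 i| < e /\ `|grad f (x k) 0 i - grad f z 0 i| < e.
Proof.
move=> e0.
pose c := theta / 8 * (e ^+ 2 / (1 + L ^+ 2)).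
have L2 : 0 < 1 + L ^+ 2 by rewrite addr_gt0// exprn_gt0.
have c0 : 0 < c by rewrite mulr_gt0 ?divr_gt0 ?exprn_gt0.
have [K hK] := objective_cvg c0; exists K => k /hK hk i.
have sqr_lt (r : R) : r ^+ 2 < e ^+ 2 -> `|r| < e.
  by rewrite -(real_normK (num_real r)) ltr_pXn2r ?nnegrE// ltW.
have hd : dot (x k - z) (x k - z) * (1 + L ^+ 2) < e ^+ 2.
  rewrite -ltr_pdivlMr//; apply: le_lt_trans (dist_minimizer_le (level_x k)) _.
  rewrite -ltr_pdivlMl ?divr_gt0// invf_div; exact: hk.
have d0 := dot_ge0 (x k - z).
have Ld0 : 0 <= L ^+ 2 * dot (x k - z) (x k - z).
  by rewrite mulr_ge0// exprn_ge0// ltW.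
rewrite mulrDr mulr1 (mulrC _ (L ^+ 2)) in hd.
split; apply: sqr_lt.
  have := coordB_sqr_le_dot (x k) z i; lra.
have := glip (level_x k) level_z.
have := coordB_sqr_le_dot (grad f (x k)) (grad f z) i; lra.
Qed.

Lemma iterates_converge :
  [/\ x @ \oo --> z,
      (fun k => phi f lambda (x k)) @ \oo --> (0 : 'rV[R]_n)
    & (fun k => beta f lambda (x k)) @ \oo --> (0 : 'rV[R]_n)].
Proof.
have [fdiff _ _] := fC2.
have res i e : 0 < e -> exists K, forall k, (K <= k)%N ->
    `|phi f lambda (x k) 0 i| < e /\ `|beta f lambda (x k) 0 i| < e.
  move=> e0; have [g1 g2 g3] := minimizer_grad fdiff lambda_gt0 i zmin.
  have [del del0 hdel] := coord_residual_small lambda_gt0 e0 g1 g2 g3.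
  have [K hK] := iterates_close del0; exists K => k /hK /(_ i)[h1 h2].
  by rewrite phiE betaE; exact: hdel.
have zi i : (0 : 'rV[R]_n) 0 i = 0 by rewrite mxE.
split; apply: cvg_rowP => i e e0.
- by have [K hK] := iterates_close e0; exists K => k /hK /(_ i)[].
- by have [K hK] := res i e e0; exists K => k /hK[]; rewrite zi subr0.
- by have [K hK] := res i e e0; exists K => k /hK[_]; rewrite zi subr0.
Qed.

End Convergence.

Theorem theorem3p11 (R : realType) (n : nat) (f : 'rV[R]_n -> R) (lambda : R)
    (x0 xstar : 'rV[R]_n) (eta_phi eta_beta xi eta gamma : R)
    (X : nat -> option 'rV[R]_n)
    (hlambda : 0 < lambda)
    (hf : standing_assumption f lambda x0)
    (heta_phi : 0 < eta_phi <= 1)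
    (heta_beta : 0 < eta_beta <= 1)
    (hxi : 0 < xi < 1)
    (heta : 0 < eta <= 2^-1)
    (hgamma : 0 < gamma)
    (hxstar : unique (minimizer (objective f lambda)) xstar)
    (hX : farsa_run f lambda eta_phi eta_beta xi eta gamma 0 x0 X) :
  (exists k : nat, X k = Some xstar) \/
  (exists x : nat -> 'rV[R]_n,
     [/\ forall k, X k = Some (x k),
         x @ \oo --> xstar,
         (fun k => phi f lambda (x k)) @ \oo --> (0 : 'rV[R]_n)
       & (fun k => beta f lambda (x k)) @ \oo --> (0 : 'rV[R]_n)]).
Proof.
have [[k hk]|never] := pselect (exists k, X k = Some xstar); first by left; exists k.
right; have [xmin xuniq] := hxstar; have [X0 Xnext] := hX.
have [fconvex fC2 _ [L L0 lip] [th [TH [th0 TH0 hbd]]]] := hf.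
have [fdiff _ _] := fC2.
have eta01 : 0 < eta < 1 by have /andP[-> eta2] := heta; lra.
have glip a b : level_set f lambda x0 a -> level_set f lambda x0 b ->
    dot (grad f a - grad f b) (grad f a - grad f b) <= L ^+ 2 * dot (a - b) (a - b).
  move=> la lb; rewrite -!sqr_norm2 -exprMn ler_pXn2r ?nnegrE ?norm2_ge0//.
    exact: lip.
  by rewrite mulr_ge0 ?norm2_ge0// ltW.
have hbd' a v : level_set f lambda x0 a ->
    th * dot v v <= quad (hess f a) v <= TH * dot v v.
  by move=> la; rewrite -sqr_norm2; exact: hbd.
have [kappa kappa0 it] := iteration_step fconvex fdiff hlambda L0 th0 TH0 hxi eta01
  glip hbd' heta_phi heta_beta hgamma.
pose x k := odflt 0 (X k).
have next k v : X k = Some v -> level_set f lambda x0 v ->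
    exists z, [/\ X k.+1 = Some z, objective f lambda z <= objective f lambda v &
      nonzeros z \proper nonzeros v \/
      kappa * residual f lambda v <= objective f lambda v - objective f lambda z].
  move=> Xk lv; have := Xnext k; rewrite Xk; apply: it => // vmin.
  by apply: never; exists k; rewrite Xk (xuniq v vmin).
have run k : X k = Some (x k) /\ level_set f lambda x0 (x k).
  elim: k => [|k [Xk lk]]; first by rewrite /x X0; split=> //=; exact: lexx.
  have [z [Xz Fz _]] := next k (x k) Xk lk.
  by rewrite /x Xz; split=> //; exact: le_trans Fz lk.
exists x.
have [|x_cvg phi_cvg beta_cvg] := iterates_converge fconvex fC2 hlambda L0 th0 glip
  (fun a v la => (andP (hbd' a v la)).1) xmin (fun k => (run k).2) kappa0.
- move=> k; have [Xk lk] := run k; have [z [Xz Fz dec]] := next k (x k) Xk lk.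
  by have -> : x k.+1 = z by rewrite /x Xz.
by split=> // k; have [] := run k.
Qed.
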